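(* Let $I$ be a finite index set. For each positive integer $N$, let $H^{(N)}\in\mathrm{Mat}_N$ be a deterministic complex Hadamard matrix, let $W^{(N)}\in\mathrm{Mat}_N$ be a uniformly distributed random signed permutation matrix, and let $\{D_i^{(N)}\}_{i\in I}$ be an i.i.d. family of uniformly distributed random $N$-by-$N$ diagonal signed permutation matrices independent of $W^{(N)}$. Then $$\left\{\left\{W^{(N)}\right\}\cup\left\{\frac{H^{(N)}}{\sqrt N}W^{(N)}\right\}\cup\left\{D_i^{(N)}\frac{H^{(N)}}{\sqrt N}W^{(N)}\right\}_{i\in I}\right\}_{N=1}^\infty$$ is an asymptotically liberating sequence of families of random unitary matrices. (For each $N$ the family is indexed by $I$ together with two additional distinct indices, one for $W^{(N)}$ and one for $\frac{H^{(N)}}{\sqrt N}W^{(N)}$.)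
   Context: $\mathrm{Mat}_N$ is the space of $N$-by-$N$ complex matrices, $A^*$ is the conjugate transpose, $[\![A]\!]$ is the largest singular value of $A$, and $\mathrm{tr}$ is the unnormalized trace. A matrix $H\in\mathrm{Mat}_N$ is a complex Hadamard matrix if $H/\sqrt N$ is unitary and $|H(i,j)|=1$ for all $i,j=1,\dots,N$. A signed permutation matrix is a matrix $W\in\mathrm{Mat}_N$ with entries $W(i,j)=\epsilon_i\delta_{i,\sigma(j)}$ for some signs $\epsilon_1,\dots,\epsilon_N\in\{\pm1\}$ and some permutation $\sigma\in S_N$; a diagonal signed permutation matrix is thus a diagonal matrix with diagonal entries in $\{\pm1\}$. Definition (asymptotically liberating). Let $I$ be a finite index set and, for each positive integer $N$ and $i\in I$, let $U_i^{(N)}\in\mathrm{Mat}_N$ be a random unitary matrix defined on a probability space depending only on $N$. The sequence of families $\{\{U_i^{(N)}\}_{i\in I}\}_{N=1}^\infty$ is asymptotically liberating if for all $i_1,\dots,i_\ell\in I$ satisfying $\ell\ge2$, $i_1\ne i_2,\ \dots,\ i_{\ell-1}\ne i_\ell$ and $i_\ell\ne i_1$, there exists a constant $c(i_1,\dots,i_\ell)$ such that $$\left|\mathbf{E}\,\mathrm{tr}\left(U_{i_1}^{(N)}A_1U_{i_1}^{(N)*}\cdots U_{i_\ell}^{(N)}A_\ell U_{i_\ell}^{(N)*}\right)\right|\le c(i_1,\dots,i_\ell)\,[\![A_1]\!]\cdots[\![A_\ell]\!]$$ for all positive integers $N$ and all constant (deterministic) matrices $A_1,\dots,A_\ell\in\mathrm{Mat}_N$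 each of trace zero. The constant may depend on $i_1,\dots,i_\ell$ but not on $N$ or $A_1,\dots,A_\ell$. *)

(* Defs.v *)
From HB Require Import structures.
From mathcomp Require Import all_boot all_order all_algebra.
From mathcomp Require Import perm spectral complex finmap.
From mathcomp Require Import all_classical all_reals all_analysis.

Set Implicit Arguments.
Unset Strict Implicit.
Unset Printing Implicit Defensive.

Import Order.TTheory GRing.Theory Num.Theory.
Local Open Scope sesquilinear_scope.
Local Open Scope complex_scope.
Local Open Scope classical_set_scope.
Local Open Scope ring_scope.

Section Matrices.
Variables (R : realType) (N : nat).
Implicit Types A H W : 'M[R[i]]_N.

Definition singular_values A : set R :=
  [set s | 0 <= s /\ eigenvalue (A^t* *m A) (s ^+ 2)%:C].

(* The set is finite, and nonempty for N > 0, so this sup is a maximum. *)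
Definition max_singular_value A : R := sup (singular_values A).

Definition div_sqrt_dim A : 'M[R[i]]_N := (sqrtC N%:R)^-1 *: A.

Definition is_complex_hadamard H : Prop :=
  div_sqrt_dim H \is unitarymx /\ forall i j, `|H i j| = 1.

Definition signed_permutation_matrices : set 'M[R[i]]_N :=
  [set W | exists (eps : 'I_N -> R[i]) (sigma : 'S_N),
     (forall i, eps i = 1 \/ eps i = -1) /\
     forall i j, W i j = eps i * (i == sigma j)%:R].

Definition diag_signed_permutation_matrices : set 'M[R[i]]_N :=
  [set W | signed_permutation_matrices W /\ is_diag_mx W].

End Matrices.

Section RandomMatrices.
Context {R : realType} {d : measure_display} {T : measurableType d}.
Variable P : probability T R.

Definition random_matrix {N} (X : T -> 'M[R[i]]_N) : Prop :=
  forall i j, measurable_fun [set: T] (fun t => complex.Re (X t i j)) /\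
              measurable_fun [set: T] (fun t => complex.Im (X t i j)).

Definition random_unitary_matrix {N} (X : T -> 'M[R[i]]_N) : Prop :=
  random_matrix X /\ forall t, X t \is unitarymx.

(* [fset_set S] is the finite set underlying [S] because [S] is finite. *)
Definition uniformly_distributed {N} (S : set 'M[R[i]]_N)
    (X : T -> 'M[R[i]]_N) : Prop :=
  [/\ finite_set S, random_matrix X, forall t, S (X t) &
      forall w, S w -> P (X @^-1` [set w]) = ((#|` fset_set S|%:R)^-1)%:E].

(* sigma(X), the sigma-algebra generated by the entries of X *)
Definition sigma_of {N} (X : T -> 'M[R[i]]_N) : set (set T) :=
  <<s [set E | exists (i j : 'I_N) (B : set R), measurable B /\
         (E = (fun t => complex.Re (X t i j)) @^-1` B \/
          E = (fun t => complex.Im (X t i j)) @^-1` B)] >>.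

Definition sigma_of_family {N} {I : finType} (X : I -> T -> 'M[R[i]]_N) :
  set (set T) := <<s \bigcup_(i in [set: I]) sigma_of (X i) >>.

Definition independent_classes (F G : set (set T)) : Prop :=
  forall A B, F A -> G B -> P (A `&` B) = (P A * P B)%E.

Definition mutually_independent {N} {I : finType} (X : I -> T -> 'M[R[i]]_N) :
    Prop :=
  forall (K : {set I}) (E : I -> set T),
    (forall i, i \in K -> sigma_of (X i) (E i)) ->
    P (\bigcap_(i in [set` K]) E i) = (\prod_(i in K) P (E i))%E.

(* Only meaningful for integrable Z (bounded and measurable in its use below,
   where the product of random unitary and constant matrices is traced). *)
Definition complex_expectation (Z : T -> R[i]) : R[i] :=
  fine 'E_P[fun t => complex.Re (Z t)] +i* fine 'E_P[fun t => complex.Im (Z t)].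

End RandomMatrices.

(* The words i_1 ... i_l are functions ix : 'I_l -> J. As [ordS] is the cyclic
   successor on 'I_l, the condition on ix says that i_1 <> i_2, ...,
   i_(l-1) <> i_l and i_l <> i_1. Only N > 0 matters. *)
Definition asymptotically_liberating {R : realType} {d : nat -> measure_display}
    {T : forall N, measurableType (d N)} (P : forall N, probability (T N) R)
    {J : finType} (U : forall N, J -> T N -> 'M[R[i]]_N) : Prop :=
  (forall N, (0 < N)%N -> forall j, random_unitary_matrix (U N j)) /\
  forall (l : nat) (ix : 'I_l -> J), (2 <= l)%N ->
    (forall k, ix k != ix (ordS k)) ->
    exists c : R, forall N, (0 < N)%N ->
      forall A : 'I_l -> 'M[R[i]]_N, (forall k, \tr (A k) = 0) ->
      `| complex_expectation (P N) (fun t =>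
           \tr (\big[mulmx/1%:M]_(k < l)
                  (U N (ix k) t *m A k *m (U N (ix k) t)^t*))) |
      <= (c * \prod_(k < l) max_singular_value (A k))%:C.

(* Main.v *)
(* Write the random unitaries as V_k W with W the signed permutation. Then the
   trace is a sum, over maps phi assigning a row and a column index to each A_k,
   of prod_k A_k(phi(k,0), phi(k,1)) times a factor built from the entries of
   V_k^* V_(k+1) after relabelling of the indices by W. Averaging over W makes
   that factor depend only on the kernel of phi (the partition into level sets)
   and kills the kernels having a singleton block. Its size is O(N^(-l/2)), since
   the entries of V_k^* V_(k+1) for i_k <> i_(k+1) are O(N^(-1/2)) in every L^p:
   they are entries of H / N^(1/2) up to signs and conjugation, or Rademacher sums
   handled by Khinchine's inequality.
   It remains to bound the sum of prod_k A_k(phi(k,0), phi(k,1)) over the phi with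
   a given singleton-free kernel by a constant times the product of the
   Hilbert-Schmidt norms, each of which is at most N^(1/2) [[A_k]]. If every block
   meets two different A_k's, this is Finner's inequality. Otherwise some block is
   exactly {(k,0), (k,1)}; tr A_k = 0 then turns the sum into minus the sum over
   the strictly coarser kernels, and one concludes by induction. *)
Require Import Defs.
From HB Require Import structures.
From mathcomp Require Import all_boot all_order all_algebra.
From mathcomp Require Import perm spectral complex finmap.
From mathcomp Require Import all_classical all_reals all_analysis.
From mathcomp Require Import ring lra.

Set Implicit Arguments.
Unset Strict Implicit.
Unset Printing Implicit Defensive.

Import Order.TTheory GRing.Theory Num.Theory.
Local Open Scope sesquilinear_scope.
Local Open Scope complex_scope.
Local Open Scope ring_scope.

(** * Finner's inequality *)

Section IteratedCauchySchwarz.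
Variable R : rcfType.

(** By Lagrange's identity, twice the right side minus the left is a sum of squares. *)
Lemma Cauchy_Schwarz_sum (X : finType) (a b : X -> R) :
  (\sum_x a x * b x) ^+ 2 <= (\sum_x a x ^+ 2) * (\sum_x b x ^+ 2).
Proof.
have lagrange : \sum_x \sum_y (a x * b y - a y * b x) ^+ 2 =
    2 * ((\sum_x a x ^+ 2) * (\sum_x b x ^+ 2) - (\sum_x a x * b x) ^+ 2).
  have -> (u v : R) : 2 * (u - v) = u + u - (v + v) by ring.
  rewrite expr2 !big_distrlr /= [X in _ + X - _]exchange_big /=.
  rewrite -!big_split -sumrB; apply: eq_bigr => x _ /=.
  rewrite -!big_split -sumrB; apply: eq_bigr => y _ /=; ring.
have : 0 <= \sum_x \sum_y (a x * b y - a y * b x) ^+ 2.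
  by apply: sumr_ge0 => x _; apply: sumr_ge0 => y _; exact: sqr_ge0.
by rewrite lagrange pmulr_rge0 ?subr_ge0.
Qed.

(** Cauchy-Schwarz is applied to the factors [k1] and [k2] alone; every other factor is bounded
    pointwise by its l2 norm. *)
Lemma sum_prod_le_prod_norm2 (X K : finType) (g : K -> X -> R) (k1 k2 : K) :
  (forall k x, 0 <= g k x) -> k1 != k2 ->
  forall D : {pred K}, k1 \in D -> k2 \in D ->
  \sum_x \prod_(k in D) g k x <= \prod_(k in D) Num.sqrt (\sum_x g k x ^+ 2).
Proof.
move=> g0 k12 D D1 D2; have s0 k : 0 <= \sum_x g k x ^+ 2.
  by apply: sumr_ge0 => x _; exact: sqr_ge0.
rewrite (bigD1 k1) // (bigD1 k2) /=; last by rewrite D2 eq_sym.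
set rest := (X in _ <= _ * (_ * X)).
have le_rest x : \prod_(k in D | (k != k1) && (k != k2)) g k x <= rest.
  rewrite /rest; under [leRHS]eq_bigl do rewrite -andbA.
  apply: ler_prod => k _; rewrite g0 /= -(ger0_norm (g0 k x)) -sqrtr_sqr.
  rewrite ler_wsqrtr // (bigD1 x) //= lerDl.
  by apply: sumr_ge0 => y _; exact: sqr_ge0.
apply: (@le_trans _ _ ((\sum_x g k1 x * g k2 x) * rest)).
  rewrite mulr_suml; apply: ler_sum => x _.
  rewrite (bigD1 k1) // (bigD1 k2) /=; last by rewrite D2 eq_sym.
  rewrite mulrA; apply: ler_wpM2l; first by rewrite mulr_ge0.
  by under eq_bigl do rewrite -andbA; exact: le_rest.
rewrite mulrA; apply: ler_wpM2r.
  by apply: prodr_ge0 => k _; exact: sqrtr_ge0.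
rewrite -sqrtrM // -[leLHS]ger0_norm; last first.
  by apply: sumr_ge0 => x _; rewrite mulr_ge0.
by rewrite -sqrtr_sqr ler_wsqrtr // Cauchy_Schwarz_sum.
Qed.

Variables X B : finType.
Implicit Types (psi : {ffun B -> X}) (s : seq B).

Definition update psi (b : B) (x : X) : {ffun B -> X} :=
  [ffun b' => if b' == b then x else psi b'].

(** Coordinates outside [s] stay frozen at [psi]; summing the others one by one suits induction on
    [s]. *)
Fixpoint iterated_sum s (G : {ffun B -> X} -> R) psi : R :=
  if s is b :: s' then \sum_x iterated_sum s' G (update psi b x) else G psi.

Lemma updateC psi b b' x x' : b != b' ->
  update (update psi b x) b' x' = update (update psi b' x') b x.
Proof.
move=> bb'; apply/ffunP => c; rewrite !ffunE.
by case: eqVneq => // ->; rewrite eq_sym (negbTE bb').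
Qed.

Lemma iterated_sum_ge0 s G psi :
  (forall psi, 0 <= G psi) -> 0 <= iterated_sum s G psi.
Proof.
by move=> G0; elim: s psi => //= b s IHs psi; apply: sumr_ge0 => x _.
Qed.

Lemma iterated_sum_update s G psi b x : b \notin s ->
  (forall psi, G (update psi b x) = G psi) ->
  iterated_sum s G (update psi b x) = iterated_sum s G psi.
Proof.
move=> + Gb; elim: s psi => //= c s IHs psi; rewrite inE negb_or => /andP[bc bs].
by apply: eq_bigr => y _; rewrite updateC // IHs.
Qed.

(* Finner's inequality with all exponents equal to 1/2, by Cauchy-Schwarz in one
   variable at a time. *)
Lemma iterated_sum_prod_le (K : finType) (f : K -> {ffun B -> X} -> R)
    (S : K -> {set B}) s psi :
  uniq s -> (forall k psi, 0 <= f k psi) ->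
  (forall k b x psi, b \notin S k -> f k (update psi b x) = f k psi) ->
  (forall b, b \in s -> exists k1 k2, [/\ k1 != k2, b \in S k1 & b \in S k2]) ->
  iterated_sum s (fun psi => \prod_k f k psi) psi <=
  \prod_k Num.sqrt
    (iterated_sum [seq b <- s | b \in S k] (fun psi => f k psi ^+ 2) psi).
Proof.
move=> + f0 fS; elim: s psi => [psi _ _|b s IHs psi /= /andP[bs us] cover] /=.
  by apply: ler_prod => k _; rewrite f0 sqrtr_sqr ler_norm.
(* [g k] is the l2 norm of [f k] over the coordinates of [s] on which it may depend. *)
pose g k psi := Num.sqrt
  (iterated_sum [seq b <- s | b \in S k] (fun psi => f k psi ^+ 2) psi).
have sq0 k t psi' : 0 <= iterated_sum t (fun psi => f k psi ^+ 2) psi'.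
  by apply: iterated_sum_ge0 => ?; exact: sqr_ge0.
have {}IHs psi' : iterated_sum s (fun psi => \prod_k f k psi) psi' <=
    \prod_k g k psi'.
  by apply: IHs => // c cs; apply: cover; rewrite inE cs orbT.
apply: (@le_trans _ _ (\sum_x \prod_k g k (update psi b x))).
  by apply: ler_sum => x _; exact: IHs.
(* Factors outside [D] do not vary with the coordinate [b] and leave the sum over [x]; by [cover],
   at least two factors remain inside. *)
pose D := [pred k | b \in S k].
have -> : \sum_x \prod_k g k (update psi b x) =
    (\sum_x \prod_(k in D) g k (update psi b x)) * \prod_(k in [predC D]) g k psi.
  rewrite mulr_suml; apply: eq_bigr => x _; rewrite (bigID [in D]) /=.
  congr (_ * _); apply: eq_bigr => k /negP/negP/= bk.
  rewrite /g iterated_sum_update //.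
    by rewrite mem_filter (negbTE bs) andbF.
  by move=> psi'; rewrite fS.
rewrite [leRHS](bigID [in D]) /=; apply: ler_pM.
- by apply: sumr_ge0 => x _; apply: prodr_ge0 => k _; exact: sqrtr_ge0.
- by apply: prodr_ge0 => k _; exact: sqrtr_ge0.
- have [k1 [k2 [k12 b1 b2]]] := cover b (mem_head _ _).
  apply: le_trans (sum_prod_le_prod_norm2 _ k12 _ _) _ => //.
    by move=> k x; exact: sqrtr_ge0.
  rewrite le_eqVlt; apply/orP; left; apply/eqP; apply: eq_bigr => k kD.
  have -> : b \in S k by []; congr Num.sqrt; apply: eq_bigr => x _.
  by rewrite sqr_sqrtr.
- rewrite le_eqVlt; apply/orP; left; apply/eqP; apply: eq_bigr => k kD.
  by have /negbTE -> : b \notin S k by [].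
Qed.

Lemma iterated_sumE s G psi : uniq s ->
  iterated_sum s G psi =
  \sum_(phi : {ffun B -> X} | [forall b, (b \in s) || (phi b == psi b)]) G phi.
Proof.
elim: s psi => [psi _|b s IHs psi /= /andP[bs us]] /=.
  rewrite (big_pred1 psi) // => phi; apply/forallP/eqP => [e|->]; last first.
    by move=> b; rewrite eqxx ?orbT.
  by apply/ffunP => b; apply/eqP; exact: e.
rewrite (partition_big (fun phi : {ffun B -> X} => phi b) xpredT) //=.
apply: eq_bigr => x _; rewrite IHs //; apply: eq_bigl => phi.
apply/forallP/andP => [e|[/forallP e /eqP phib] c]; last first.
  rewrite ffunE; have := e c; rewrite inE; case: eqVneq => [->|//].
  by rewrite phib eqxx orbT.
split; last by have := e b; rewrite (negbTE bs) ffunE eqxx.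
by apply/forallP => c; have := e c; rewrite inE ffunE; case: (eqVneq c b).
Qed.

End IteratedCauchySchwarz.

(** * Sums over maps with a given kernel *)

Section ComplexModulus.
Variable R : rcfType.
Implicit Types z w : R[i].

(** The norm [|z|] lives in [R[i]]; taking its real part allows estimates in the ordered field
    [R]. *)
Definition modulus z : R := complex.Re `|z|.

Lemma modulusE z : (modulus z)%:C = `|z|.
Proof. by rewrite /modulus normc_def. Qed.

Lemma modulus_ge0 z : 0 <= modulus z.
Proof. by rewrite -ler0c modulusE normr_ge0. Qed.

Lemma modulusM z w : modulus (z * w) = modulus z * modulus w.
Proof. by apply: complexI; rewrite rmorphM /= !modulusE normrM. Qed.

Lemma modulus_prod (K : finType) (F : K -> R[i]) :
  modulus (\prod_k F k) = \prod_k modulus (F k).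
Proof.
apply: complexI; rewrite rmorph_prod /= modulusE normr_prod.
by apply: eq_bigr => k _; rewrite modulusE.
Qed.

Lemma modulus_sum (K : finType) (P : pred K) (F : K -> R[i]) :
  modulus (\sum_(k | P k) F k) <= \sum_(k | P k) modulus (F k).
Proof.
rewrite -lecR modulusE rmorph_sum /=; apply: le_trans (ler_norm_sum _ _ _) _.
by apply: ler_sum => k _; rewrite modulusE.
Qed.

Lemma modulusN z : modulus (- z) = modulus z.
Proof. by rewrite /modulus normrN. Qed.

Lemma modulus0 : modulus 0 = 0.
Proof. by rewrite /modulus normr0. Qed.

Lemma modulus_nat n : modulus (n%:R : R[i]) = n%:R.
Proof. by apply: complexI; rewrite modulusE normr_nat rmorph_nat. Qed.

End ComplexModulus.

Lemma sum_subsingleton_le (R : numDomainType) (X : finType) (Q : pred X) (c : R) :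
  0 <= c -> (forall x y, Q x -> Q y -> x = y) -> \sum_(x | Q x) c <= c.
Proof.
move=> c0 Qinj; have [x Qx|Q0] := pickP Q; last by rewrite big_pred0.
rewrite (big_pred1 x) // => y; apply/idP/eqP => [Qy|->//]; exact: Qinj.
Qed.

(** * Kernels of index maps and the sums attached to them *)

Section KernelSums.
Variables (R : rcfType) (X K : finType).
Local Notation point := (K * bool)%type.
Implicit Types (phi : {ffun point -> X}) (rho : {set point * point}).
Implicit Types (A : K -> X -> X -> R[i]).

(** Encoding the partition as a set of pairs turns coarsening into inclusion, and the size of the
    complement into an induction measure. *)
Definition kernel phi : {set point * point} := [set q | phi q.1 == phi q.2].

Definition no_singleton_block rho :=
  [forall p, exists q, (q != p) && ((q, p) \in rho)].

(** With blocks as vertices and each [k] as an edge from the block of [(k, false)] to that of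
    [(k, true)], this describes a vertex whose only edge is the loop [k]. *)
Definition loop_block rho k :=
  (((k, false), (k, true)) \in rho) &&
  [forall q : point, ((q, (k, false)) \in rho) ==> (q.1 == k)].

Definition edge_product A phi : R[i] := \prod_k A k (phi (k, false)) (phi (k, true)).

Definition hilbert_schmidt (a : X -> X -> R[i]) : R :=
  Num.sqrt (\sum_x \sum_y modulus (a x y) ^+ 2).

Lemma kernelP phi p q : reflect (phi p = phi q) ((p, q) \in kernel phi).
Proof. by rewrite inE; exact: eqP. Qed.

(** A partner of [p] in its block either belongs to another matrix or is the other index of the same
    one; in the latter case the block, not being a loop, has a further member. This is the covering
    hypothesis of Finner's inequality. *)
Lemma loopfree_cover phi p : no_singleton_block (kernel phi) ->
  (forall k, ~~ loop_block (kernel phi) k) ->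
  exists2 q, q.1 != p.1 & phi q = phi p.
Proof.
move=> /forallP/(_ p)/existsP[q /andP[qp /kernelP phiq]] noloop.
have [qp1|] := eqVneq q.1 p.1; last by exists q.
have := noloop p.1; rewrite negb_and => /orP[/negP[]|].
  case: p q qp qp1 phiq => [k []] [k' []] //= + k'k; rewrite k'k ?eqxx // => _ e.
    exact/kernelP.
  exact/kernelP/esym.
rewrite negb_forall => /existsP[p']; rewrite negb_imply => /andP[/kernelP e ne].
exists p' => //; rewrite e.
by case: p q qp qp1 phiq {ne e} => [k []] [k' []] //= + k'k; rewrite k'k ?eqxx.
Qed.

(** Fix [phi0] with kernel [rho]. Every [phi] with that kernel is [psi] composed with [phi0], so the
    sum runs over one free variable per block, and Finner's inequality applies. *)
Lemma sum_kernel_loopfree A rho : no_singleton_block rho ->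
  (forall k, ~~ loop_block rho k) ->
  \sum_(phi | kernel phi == rho) modulus (edge_product A phi) <=
  \prod_k hilbert_schmidt (A k).
Proof.
move=> nsing noloop; have prod0 : 0 <= \prod_k hilbert_schmidt (A k).
  by apply: prodr_ge0 => k _; exact: sqrtr_ge0.
have [phi0 /eqP rho_def|none] := pickP (fun phi => kernel phi == rho); last first.
  by rewrite big1 // => phi; rewrite none.
rewrite -{rho}rho_def in nsing noloop *.
pose h (psi : {ffun X -> X}) : {ffun point -> X} := [ffun p => psi (phi0 p)].
(* Values of [phi0] name the blocks; off these values [psi] is pinned to the identity, so that [phi]
   determines [psi]. *)
pose h' phi : {ffun X -> X} :=
  [ffun x => if [pick p | phi0 p == x] is Some p then phi p else x].
rewrite (reindex_onto h h') => [|phi /eqP kphi]; last first.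
  apply/ffunP => p; rewrite !ffunE.
  case: pickP => [q /eqP /kernelP|/(_ p)]; last by rewrite eqxx.
  by rewrite -kphi => /kernelP.
pose s := undup (codom phi0).
pose f k (psi : {ffun X -> X}) : R :=
  modulus (A k (psi (phi0 (k, false))) (psi (phi0 (k, true)))).
pose psi0 : {ffun X -> X} := [ffun x => x].
apply: (@le_trans _ _ (iterated_sum s (fun psi => \prod_k f k psi) psi0)).
  (* Distinct blocks are no longer required to take distinct values, which only adds nonnegative
     terms. *)
  rewrite iterated_sumE ?undup_uniq // [leLHS]big_mkcond [leRHS]big_mkcond.
  apply: ler_sum => psi _; case: ifP => [/andP[_ /eqP hpsi]|_]; last first.
    by case: ifP => // _; apply: prodr_ge0 => k _; exact: modulus_ge0.
  rewrite ifT ?modulus_prod; first by apply: ler_prod => k _; rewrite modulus_ge0 /f !ffunE /=.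
  apply/forallP => x; rewrite mem_undup; case: codomP => //= nx.
  rewrite -hpsi !ffunE; case: pickP => [p /eqP e|//].
  by case: nx; exists p.
pose S k := [set phi0 (k, false); phi0 (k, true)].
apply: le_trans (iterated_sum_prod_le (S := S) _ _ _ _ _) _.
- exact: undup_uniq.
- by move=> k psi; exact: modulus_ge0.
- move=> k b x psi; rewrite !inE negb_or => /andP[b1 b2].
  by rewrite /f !ffunE eq_sym (negbTE b1) eq_sym (negbTE b2).
- move=> b; rewrite mem_undup => /codomP[p ->].
  have [q qp e] := loopfree_cover p nsing noloop.
  have inS r : phi0 r \in S r.1.
    by rewrite !inE; case: r => k [] /=; rewrite eqxx ?orbT.
  by exists q.1, p.1; split => //; rewrite -e.
apply: ler_prod => k _; rewrite sqrtr_ge0 ler_wsqrtr //.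
rewrite iterated_sumE ?filter_uniq ?undup_uniq //.
(* Each pair [(x, y)] is attained by at most one [psi]; if the two indices of [k] share a block,
   only diagonal entries occur. *)
rewrite (partition_big (fun psi : {ffun X -> X} =>
  (psi (phi0 (k, false)), psi (phi0 (k, true)))) xpredT) //= pair_big /=.
apply: ler_sum => -[x y] _ /=.
apply: (@le_trans _ _ (\sum_(psi : {ffun X -> X} |
    [forall b, (b \in [seq b <- s | b \in S k]) || (psi b == psi0 b)] &&
    ((psi (phi0 (k, false)), psi (phi0 (k, true))) == (x, y)))
    modulus (A k x y) ^+ 2)).
  by apply: ler_sum => psi /andP[_ /eqP[<- <-]]; rewrite /f.
apply: sum_subsingleton_le => [|psi psi'].
  by rewrite exprn_ge0 ?modulus_ge0.
move=> /andP[/forallP a1 /eqP[b1 c1]] /andP[/forallP a2 /eqP[b2 c2]].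
apply/ffunP => b; have := a1 b; have := a2 b.
rewrite mem_filter; have [|] := boolP (b \in S k).
  by rewrite !inE => /orP[] /eqP -> _ _; rewrite ?b1 ?b2 ?c1 ?c2.
by rewrite /= => _ /eqP -> /eqP ->.
Qed.

(** Once coarser kernels are allowed, the common value on the loop block ranges freely over [X],
    independently of the rest, so the trace of [A k] factors out. *)
Lemma sum_loop_block A phi0 k :
  \sum_x A k x x = 0 -> loop_block (kernel phi0) k ->
  \sum_(phi | kernel phi0 \subset kernel phi) edge_product A phi = 0.
Proof.
move=> trA /andP[inpi /forallP loop].
have blockE p : (phi0 p == phi0 (k, false)) = (p.1 == k).
  apply/eqP/eqP => [e|]; first by apply/eqP/(implyP (loop p))/kernelP.
  case: p => [j []] //= -> //; exact/esym/kernelP.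
have [x0|X0] := pickP (fun _ : X => true); last first.
  rewrite big1 // => phi _; have := X0 (phi (k, true)); discriminate.
pose mk phi x : {ffun point -> X} := [ffun p => if p.1 == k then x else phi p].
(* Maps are grouped by their values off the loop block, the value on it being overwritten by
   [x0]. *)
rewrite (partition_big (mk^~ x0) xpredT) //= big1 // => phi' _.
set Q := (X in \sum_(i | X i) _).
have [phi1 Q1|Q0] := pickP Q; last by rewrite big_pred0.
rewrite (reindex_onto (mk phi1) (fun phi => phi (k, false))) /=; last first.
  move=> phi /andP[/fintype.subsetP Pphi /eqP e]; apply/ffunP => -[j b]; rewrite ffunE /=.
  case: eqVneq => [->|jk]; last first.
    have /andP[_ /eqP e1] := Q1; have := congr1 (fun f : {ffun point -> X} => f (j, b)) e.
    by rewrite -e1 !ffunE /= (negbTE jk).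
  by case: b => //; apply/kernelP/Pphi.
rewrite (eq_bigl xpredT) => [|x]; last first.
  case/andP: Q1 => /fintype.subsetP P1 /eqP e1; rewrite /Q ffunE /= eqxx eqxx andbT -e1.
  apply/andP; split; last first.
    by apply/eqP/ffunP => p; rewrite !ffunE; case: eqP.
  apply/fintype.subsetP => -[p q] pq; apply/kernelP; rewrite !ffunE -!blockE.
  rewrite -(elimT (kernelP _ _ _) pq); case: ifP => // _.
  exact/kernelP/P1.
rewrite (eq_bigr (fun x => A k x x *
    \prod_(j | j != k) A j (phi1 (j, false)) (phi1 (j, true)))) => [|x _].
  by rewrite -mulr_suml trA mul0r.
rewrite /edge_product (bigD1 k) //= !ffunE /= eqxx; congr (_ * _).
by apply: eq_bigr => j /negbTE jk; rewrite !ffunE /= jk.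
Qed.

(** Induction on the number of pairs separated by [rho]. When there is a loop block, the sum is
    minus that over strictly coarser kernels; their number is at most [#|{set point * point}|],
    which costs one such factor per level. *)
Lemma sum_kernel_bound A rho (n : nat) : (forall k, \sum_x A k x x = 0) ->
  no_singleton_block rho -> (#|~: rho| < n)%N ->
  modulus (\sum_(phi | kernel phi == rho) edge_product A phi) <=
  #|{set point * point}|%:R ^+ n * \prod_k hilbert_schmidt (A k).
Proof.
move=> trA; elim: n rho => // n IHn rho nsing ltn.
have prod0 : 0 <= \prod_k hilbert_schmidt (A k).
  by apply: prodr_ge0 => k _; exact: sqrtr_ge0.
have card1 : 1 <= #|{set point * point}|%:R :> R.
  by rewrite ler1n; apply/card_gt0P; exists finset.set0.
have [phi0 /eqP rho_def|none] := pickP (fun phi => kernel phi == rho); last first.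
  rewrite big1 => [|phi]; last by rewrite none.
  by rewrite modulus0 mulr_ge0 // exprn_ge0 // ler0n.
have [/existsP[k loop]|noloop] := boolP [exists k, loop_block rho k]; last first.
  apply: le_trans (modulus_sum _ _) _.
  apply: le_trans (sum_kernel_loopfree _ nsing _) _.
    by move=> k; apply: contra noloop => loop; apply/existsP; exists k.
  by apply: ler_peMl => //; exact: exprn_ege1.
have := sum_loop_block (A := A) (phi0 := phi0) (trA k).
rewrite rho_def => /(_ loop).
rewrite (partition_big kernel (fun rho' => rho \subset rho')) //= (bigD1 rho) //=.
rewrite (eq_bigl (fun phi => kernel phi == rho)) => [|phi]; last first.
  by apply: andb_idl => /eqP ->.
move/eqP; rewrite addr_eq0 => /eqP ->; rewrite modulusN.
apply: le_trans (modulus_sum _ _) _.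
apply: (@le_trans _ _ (\sum_(rho' : {set point * point})
    #|{set point * point}|%:R ^+ n * \prod_k hilbert_schmidt (A k))).
  rewrite [leLHS]big_mkcond; apply: ler_sum => rho' _.
  case: ifP => [/andP[sub ne]|_]; last first.
    by rewrite mulr_ge0 // exprn_ge0 // ler0n.
  rewrite (eq_bigl (fun phi => kernel phi == rho')) => [|phi]; last first.
    by apply: andb_idl => /eqP ->.
  apply: IHn.
    apply/forallP => p; have /existsP[q /andP[qp qr]] := forallP nsing p.
    by apply/existsP; exists q; rewrite qp (fintype.subsetP sub).
  rewrite -ltnS (leq_trans _ ltn) // ltnS; apply: proper_card.
  by rewrite properE finset.setCS sub finset.setCS finset.eqEsubset sub andbT in ne *.
by rewrite sumr_const -[leLHS]mulr_natl mulrA -exprS.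
Qed.

End KernelSums.

(** * Khinchine's inequality *)

Section Khinchine.
Variable R : rcfType.

Lemma modulus_sqr (z : R[i]) :
  modulus z ^+ 2 = complex.Re z ^+ 2 + complex.Im z ^+ 2.
Proof.
by apply: complexI; rewrite rmorphXn /= modulusE -add_Re2_Im2.
Qed.

(** The real inequality behind one step of Khinchine: [s + t] and [s - t] will be the squared moduli
    of [z + u] and [z - u], shifted by [r]. *)
Lemma symmetrized_power_le (s t c : R) (p : nat) :
  0 <= s -> 0 <= s + t -> 0 <= s - t -> t ^+ 2 <= 4 * s -> (4 * p)%:R <= c ->
  (s + t) ^+ p + (s - t) ^+ p <= 2 * (s + c) ^+ p.
Proof.
move=> s0 st0 st0' t2 pc; have c0 : 0 <= c by apply: le_trans pc; exact: ler0n.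
have sc0 k : 0 <= (s + c) ^+ k by rewrite exprn_ge0 // addr_ge0.
(* The even part at [p.+1] involves [t] times the odd part at [p], so both are bounded in a joint
   induction; [t ^+ 2 <= 4 * s] returns from odd to even. *)
suff [] : (s + t) ^+ p + (s - t) ^+ p <= 2 * (s + c) ^+ p /\
    t * ((s + t) ^+ p - (s - t) ^+ p) <= 8 * p%:R * (s + c) ^+ p by [].
elim: p pc => [|p IHp] pc; first by rewrite !expr0; split; lra.
have pc' : (4 * p)%:R <= c by apply: le_trans pc; rewrite ler_nat leq_mul2l leqnSn.
have [le_a le_b] := IHp pc'.
have a0 : 0 <= (s + t) ^+ p + (s - t) ^+ p by rewrite addr_ge0 ?exprn_ge0.
rewrite !exprS; move: le_a le_b a0 (sc0 p).
set x := (s + t) ^+ p; set y := (s - t) ^+ p; set w := (s + c) ^+ p.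
move=> le_a le_b a0 w0; rewrite natrM in pc'; split.
  have -> : (s + t) * x + (s - t) * y = s * (x + y) + t * (x - y) by ring.
  have := ler_wpM2l s0 le_a; have := ler_wpM2r w0 pc'; lra.
have -> : t * ((s + t) * x - (s - t) * y) =
    s * (t * (x - y)) + t ^+ 2 * (x + y) by ring.
have h1 := ler_wpM2l s0 le_b; have h2 := ler_wpM2r a0 t2.
have h3 := ler_wpM2l s0 le_a.
have h4 : 0 <= 8 * p.+1%:R * (c * w) by rewrite !mulr_ge0.
rewrite -natr1 in h4 *; lra.
Qed.

Definition ffun_cons (T : Type) n (x : T) (f : {ffun 'I_n -> T}) :
    {ffun 'I_n.+1 -> T} :=
  [ffun i => if unlift ord0 i is Some j then f j else x].

Lemma ffun_cons0 (T : Type) n (x : T) (f : {ffun 'I_n -> T}) :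
  ffun_cons x f ord0 = x.
Proof. by rewrite ffunE unlift_none. Qed.

Lemma ffun_consS (T : Type) n (x : T) (f : {ffun 'I_n -> T}) j :
  ffun_cons x f (lift ord0 j) = f j.
Proof. by rewrite ffunE liftK. Qed.

Lemma sum_ffun_recl (V : nmodType) (T : finType) n (G : {ffun 'I_n.+1 -> T} -> V) :
  \sum_f G f = \sum_x \sum_(f : {ffun 'I_n -> T}) G (ffun_cons x f).
Proof.
rewrite pair_big /=; apply: reindex.
exists (fun f : {ffun 'I_n.+1 -> T} => (f ord0, [ffun j => f (lift ord0 j)])).
  case=> x f _; rewrite ffun_cons0; congr pair; apply/ffunP => j.
  by rewrite ffunE ffun_consS.
move=> f _; apply/ffunP => i; rewrite ffunE.
by case: unliftP => [j ->|->]; rewrite ?ffunE.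
Qed.

(** The cross term [t] is twice the real inner product of [z] and [u], so Cauchy-Schwarz bounds its
    square by four times that of [modulus z]. *)
Lemma parallelogram_powers_le (z u : R[i]) (p : nat) (r : R) :
  modulus u = 1 -> 0 <= r ->
  (modulus (z + u) ^+ 2 + r) ^+ p + (modulus (z - u) ^+ 2 + r) ^+ p <=
  2 * (modulus z ^+ 2 + r + (4 * p).+1%:R) ^+ p.
Proof.
move=> u1 r0; have := modulus_sqr u; rewrite u1 expr1n => u2.
pose t := 2 * (complex.Re z * complex.Re u + complex.Im z * complex.Im u).
pose s := modulus z ^+ 2 + 1 + r.
have es : modulus (z + u) ^+ 2 + r = s + t.
  rewrite /s u2 !modulus_sqr /t.
  by case: z u {u1 u2 t s} => [a b] [c d] /=; ring.
have es' : modulus (z - u) ^+ 2 + r = s - t.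
  rewrite /s u2 !modulus_sqr /t.
  by case: z u {u1 u2 t s es} => [a b] [c d] /=; ring.
have z0 : 0 <= modulus z ^+ 2 by exact: sqr_ge0.
(* Of the increment [(4 * p).+1], the 1 is the squared modulus of [u] and [4 * p] is the constant
   [c] of [symmetrized_power_le]. *)
rewrite -[(4 * p).+1]addn1 natrD [_ + 1]addrC addrA [_ + r + 1]addrAC -/s es es'.
apply: symmetrized_power_le => //.
- by rewrite !addr_ge0.
- by rewrite -es addr_ge0 ?sqr_ge0.
- by rewrite -es' addr_ge0 ?sqr_ge0.
rewrite /s; apply: (@le_trans _ _ (4 * modulus z ^+ 2)); last lra.
have -> : 4 * modulus z ^+ 2 = 4 * modulus z ^+ 2 *
  (complex.Re u ^+ 2 + complex.Im u ^+ 2) by rewrite -u2 mulr1.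
rewrite modulus_sqr /t -subr_ge0.
case: z u {u1 u2 t s es es' z0} => [a b] [c d] /=.
have := sqr_ge0 (a * d - b * c); lra.
Qed.

(** The shift [z] makes induction on [n] possible: the first signed term is absorbed into it, and
    averaging over that sign adds [(4 * p).+1]. *)
Lemma Khinchine_shifted (p n : nat) (u : 'I_n -> R[i]) (z : R[i]) :
  (forall c, modulus (u c) = 1) ->
  \sum_(s : {ffun 'I_n -> bool})
    (modulus (z + \sum_c (-1) ^+ s c * u c) ^+ 2) ^+ p <=
  2 ^+ n * (modulus z ^+ 2 + (4 * p).+1%:R * n%:R) ^+ p.
Proof.
elim: n u z => [|n IHn] u z u1.
  rewrite (eq_bigr (fun=> (modulus z ^+ 2) ^+ p)) => [|s _]; last first.
    by rewrite big_ord0 addr0.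
  by rewrite sumr_const card_ffun card_ord expn0 mulr0 addr0 mul1r.
rewrite sum_ffun_recl big_bool /=.
have step b : \sum_(s : {ffun 'I_n -> bool}) (modulus (z + \sum_c
      (-1) ^+ (ffun_cons b s) c * u c) ^+ 2) ^+ p <=
    2 ^+ n * (modulus (z + (-1) ^+ b * u ord0) ^+ 2 +
              (4 * p).+1%:R * n%:R) ^+ p.
  apply: le_trans (IHn (fun c => u (lift ord0 c)) _ _) => //.
  rewrite le_eqVlt; apply/orP; left; apply/eqP; apply: eq_bigr => s _.
  rewrite big_ord_recl ffun_cons0 addrA; congr ((modulus (_ + _) ^+ 2) ^+ p).
  by apply: eq_bigr => c _; rewrite ffun_consS.
apply: le_trans (lerD (step true) (step false)) _.
rewrite expr1 expr0 mul1r mulN1r -mulrDr [2 ^+ n.+1]exprSr -mulrA ler_pM2l ?exprn_gt0 //.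
have r0 : 0 <= (4 * p).+1%:R * n%:R :> R by rewrite mulr_ge0 ?ler0n.
rewrite addrC; apply: le_trans (parallelogram_powers_le _ _ (u1 _) r0) _.
by rewrite -addrA -[n.+1]addn1 [(n + 1)%:R]natrD mulrDr mulr1.
Qed.

Lemma Khinchine (p n : nat) (u : 'I_n -> R[i]) :
  (forall c, modulus (u c) = 1) ->
  \sum_(s : {ffun 'I_n -> bool}) (modulus (\sum_c (-1) ^+ s c * u c) ^+ 2) ^+ p <=
  2 ^+ n * ((4 * p).+1%:R * n%:R) ^+ p.
Proof.
move=> u1; have := Khinchine_shifted p 0 u1; rewrite modulus0 expr0n add0r.
by under eq_bigr do rewrite add0r.
Qed.

End Khinchine.

(** * Averaging over signed permutations *)

Section CyclicTrace.
Variables (R : rcfType) (N : nat).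
Local Notation C := R[i].

(** The path starts at [i] and has [n] intermediate indices; [ordS] would wrap around at [ord_max],
    so the last column index is set to [j] there. *)
Lemma prodmx_entry n (X : 'I_n.+1 -> 'M[C]_N) i j :
  (\big[mulmx/1%:M]_k X k) i j = \sum_(c : {ffun 'I_n -> 'I_N})
    \prod_k X k (ffun_cons i c k)
      (if k == ord_max then j else ffun_cons i c (ordS k)).
Proof.
elim: n X i => [|n IHn] X i.
  rewrite big_ord_recl big_ord0 mulmx1 (eq_bigr (fun=> X ord0 i j)) => [|c _].
    by rewrite sumr_const card_ffun [#|'I_0|]card_ord expn0.
  by rewrite big_ord1 ffun_cons0 (ord1 ord_max) eqxx.
rewrite big_ord_recl mxE sum_ffun_recl; apply: eq_bigr => x _.
rewrite IHn mulr_sumr; apply: eq_bigr => c _.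
rewrite [RHS]big_ord_recl ffun_cons0 /=; congr (X _ _ _ * _).
  have -> : ordS ord0 = lift ord0 ord0 :> 'I_n.+2 by exact: val_inj.
  by rewrite ffun_consS ffun_cons0.
apply: eq_bigr => k _; rewrite ffun_consS.
have -> : (lift ord0 k == ord_max) = (k == ord_max) by [].
case: ifP => // kmax; congr (X _ _ _); rewrite -[LHS](ffun_consS i).
congr (ffun_cons i _ _); apply: val_inj; rewrite /= /bump !add1n.
have kn : val k != n by apply: contraFneq kmax => e; apply/eqP/val_inj.
have kn' : (k < n)%N by rewrite ltn_neqAle kn -ltnS ltn_ord.
by rewrite !modn_small.
Qed.

Lemma trace_prodmx n (X : 'I_n.+1 -> 'M[C]_N) :
  \tr (\big[mulmx/1%:M]_k X k) =
  \sum_(c : {ffun 'I_n.+1 -> 'I_N}) \prod_k X k (c k) (c (ordS k)).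
Proof.
rewrite sum_ffun_recl /mxtrace; apply: eq_bigr => i _; rewrite prodmx_entry.
apply: eq_bigr => c _; apply: eq_bigr => k _; congr (X _ _ _).
case: eqP => // ->; have -> : ordS ord_max = ord0 :> 'I_n.+1.
  by apply: val_inj => /=; rewrite modnn.
by rewrite ffun_cons0.
Qed.

(** [phi] records the row and column index of each [B k]; summing out the indices between
    consecutive conjugates assembles the products of the adjoint of [V k] with [V (ordS k)]. *)
Lemma trace_prod_conjugates n (V B : 'I_n.+1 -> 'M[C]_N) :
  \tr (\big[mulmx/1%:M]_k (V k *m B k *m (V k)^t*)) =
  \sum_(phi : {ffun 'I_n.+1 * bool -> 'I_N})
    (\prod_k B k (phi (k, false)) (phi (k, true))) *
    \prod_k ((V k)^t* *m V (ordS k)) (phi (k, true)) (phi (ordS k, false)).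
Proof.
rewrite trace_prodmx.
pose F k x ab y := V k x ab.1 * B k ab.1 ab.2 * (V k y ab.2)^*.
have entry k x y : (V k *m B k *m (V k)^t*) x y = \sum_ab F k x ab y.
  rewrite mxE (eq_bigr (fun b => \sum_a F k x (a, b) y)) => [|b _].
    rewrite exchange_big pair_big /=; apply: eq_bigr => -[a b] _ //.
  by rewrite !mxE mulr_suml.
under eq_bigr => c _.
  under eq_bigr do rewrite entry.
  rewrite bigA_distr_bigA /=.
  over.
rewrite exchange_big /=.
pose h (phi : {ffun 'I_n.+1 * bool -> 'I_N}) : {ffun 'I_n.+1 -> 'I_N * 'I_N} :=
  [ffun k => (phi (k, false), phi (k, true))].
rewrite (reindex h) /=; last first.
  exists (fun f : {ffun 'I_n.+1 -> 'I_N * 'I_N} =>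
    [ffun p : 'I_n.+1 * bool => if p.2 then (f p.1).2 else (f p.1).1]).
    by move=> phi _; apply/ffunP => -[k []]; rewrite !ffunE.
  by move=> f _; apply/ffunP => k; rewrite !ffunE /=; case: (f k).
apply: eq_bigr => phi _.
pose G k x := (V k x (phi (k, true)))^* * V (ordS k) x (phi (ordS k, false)).
(* The index [c (ordS k)] is shared by the adjoint of [V k] and by [V (ordS k)]; rotating the
   product of the [V k] by [ordS] pairs them. *)
rewrite (eq_bigr (fun c : {ffun 'I_n.+1 -> 'I_N} =>
    (\prod_k B k (phi (k, false)) (phi (k, true))) * \prod_k G k (c (ordS k))));
    last first.
  move=> c _; rewrite /F /G; under eq_bigr do rewrite ffunE /=.
  rewrite !big_split /= (reindex (@ordS n.+1)) /=; last first.
    exact/onW_bij/ordS_bij.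
  by rewrite mulrAC mulrC; congr (_ * _); rewrite mulrC.
rewrite -mulr_sumr; congr (_ * _).
rewrite (reindex (fun c : {ffun 'I_n.+1 -> 'I_N} => [ffun k => c (ord_pred k)])).
  under eq_bigr do under eq_bigr do rewrite ffunE ordSK.
  rewrite -bigA_distr_bigA; apply: eq_bigr => k _; rewrite mxE.
  by apply: eq_bigr => x _; rewrite !mxE.
exists (fun c : {ffun 'I_n.+1 -> 'I_N} => [ffun k => c (ordS k)]) => c _.
  by apply/ffunP => k; rewrite !ffunE ordSK.
by apply/ffunP => k; rewrite !ffunE ord_predK.
Qed.

End CyclicTrace.

(** * Sums over signs and permutations *)

Section SignedPermutationAverage.
Variables (R : rcfType) (N : nat).
Local Notation C := R[i].
Implicit Types (eps : {ffun 'I_N -> bool}) (sg : 'S_N).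

Definition signed_perm_mx eps sg : 'M[C]_N :=
  \matrix_(i, j) ((-1) ^+ eps i * (i == sg j)%:R).

Lemma signed_perm_mx_conj eps sg (A : 'M[C]_N) a b :
  (signed_perm_mx eps sg *m A *m (signed_perm_mx eps sg)^t*) (sg a) (sg b) =
  (-1) ^+ eps (sg a) * (-1) ^+ eps (sg b) * A a b.
Proof.
rewrite mxE (bigD1 b) //= big1 ?addr0 => [|y yb]; last first.
  by rewrite !mxE (inj_eq perm_inj) eq_sym (negbTE yb) mulr0 rmorph0 mulr0.
rewrite !mxE eqxx mulr1 rmorph_sign.
rewrite (bigD1 a) //= big1 ?addr0 => [|x xa]; last first.
  by rewrite !mxE (inj_eq perm_inj) eq_sym (negbTE xa) mulr0 mul0r.
by rewrite !mxE eqxx mulr1 mulrAC.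
Qed.

(** Equal kernels give a bijection between the images, which is extended to a permutation by adding
    one transposition per point. *)
Lemma perm_of_kernel (P : finType) (phi phi' : {ffun P -> 'I_N}) :
  (forall p q, (phi p == phi q) = (phi' p == phi' q)) ->
  exists tau : 'S_N, forall p, tau (phi p) = phi' p.
Proof.
move=> same.
suff ext (s : seq P) : exists tau : 'S_N, forall p, p \in s -> tau (phi p) = phi' p.
  by have [tau tauE] := ext (enum P); exists tau => p; rewrite tauE ?mem_enum.
elim: s => [|p s [tau tauE]]; first by exists 1%g.
(* [tau] acts first; the transposition then corrects the value at [phi p] and leaves the values
   already prescribed unchanged. *)
exists (tau * tperm (tau (phi p)) (phi' p))%g => q; rewrite inE permM.
case: (eqVneq q p) => [-> _|_ /= qs]; first by rewrite tpermL.
rewrite (tauE q) //; have [e|ne] := eqVneq (phi' q) (phi' p).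
  have /eqP phiqp : phi q == phi p by rewrite same e.
  by rewrite -phiqp (tauE q) // e tpermL.
rewrite tpermD // eq_sym // -(tauE q qs) (inj_eq perm_inj) same.
by rewrite eq_sym in ne *.
Qed.

(** Flipping the sign at [phi p0], an index that occurs exactly once, is an involution negating
    every term. *)
Lemma signs_cancel (P : finType) (phi : {ffun P -> 'I_N}) (p0 : P) :
  (forall q, q != p0 -> phi q != phi p0) ->
  \sum_(eps : {ffun 'I_N -> bool}) \prod_p (-1) ^+ eps (phi p) = 0 :> C.
Proof.
move=> single.
pose flip eps : {ffun 'I_N -> bool} := [ffun x => (x == phi p0) (+) eps x].
have flipK : involutive flip.
  by move=> eps; apply/ffunP => x; rewrite !ffunE addKb.
set S := LHS; suff : S = - S by move/eqP; rewrite -addr_eq0 -mulr2n mulrn_eq0 => /eqP.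
rewrite {1}/S (reindex_inj (inv_inj flipK)) -sumrN; apply: eq_bigr => eps _.
rewrite (bigD1 p0) // [in RHS](bigD1 p0) //= ffunE eqxx signr_addb mulN1r mulNr.
congr (- (_ * _)); apply: eq_bigr => q /single qp.
by rewrite ffunE (negbTE qp).
Qed.

Variables (Delta : finType) (n : nat).
Variables (V : Delta -> 'I_n.+1 -> 'M[C]_N).
Local Notation point := ('I_n.+1 * bool)%type.
Implicit Types phi : {ffun point -> 'I_N}.

Definition link delta k := (V delta k)^t* *m V delta (ordS k).

Definition link_product delta phi : C :=
  \prod_k link delta k (phi (k, true)) (phi (ordS k, false)).

Definition move_by sg phi : {ffun point -> 'I_N} := [ffun p => sg (phi p)].

(** The cofactor of [edge_product] after summation over all random choices; plain sums replace
    expectations, and the normalisation comes at the end. *)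
Definition kernel_weight phi : C :=
  \sum_sg (\sum_(eps : {ffun 'I_N -> bool})
             \prod_p (-1) ^+ eps (move_by sg phi p)) *
          (\sum_delta link_product delta (move_by sg phi)).

(** At indices moved by [sg], the conjugated [A k] has the entries of [A k] up to signs; reindexing
    by [move_by sg] thus frees the [A k] from the randomness. *)
Lemma sum_signed_perm_trace (A : 'I_n.+1 -> 'M[C]_N) :
  \sum_eps \sum_sg \sum_delta \tr (\big[mulmx/1%:M]_k
    (V delta k *m signed_perm_mx eps sg *m A k *m
      (V delta k *m signed_perm_mx eps sg)^t*)) =
  \sum_phi edge_product (fun k => A k) phi * kernel_weight phi.
Proof.
under [RHS]eq_bigr do rewrite mulr_sumr.
rewrite [RHS]exchange_big [LHS]exchange_big /=; apply: eq_bigr => sg _.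
transitivity (\sum_(eps : {ffun 'I_N -> bool}) \sum_delta \sum_phi
    edge_product (fun k => A k) phi *
    ((\prod_p (-1) ^+ eps (move_by sg phi p)) *
     link_product delta (move_by sg phi))).
  apply: eq_bigr => eps _; apply: eq_bigr => delta _.
  pose B k := signed_perm_mx eps sg *m A k *m (signed_perm_mx eps sg)^t*.
  have -> : \big[mulmx/1%:M]_k (V delta k *m signed_perm_mx eps sg *m A k *m
      (V delta k *m signed_perm_mx eps sg)^t*) =
      \big[mulmx/1%:M]_k (V delta k *m B k *m (V delta k)^t*).
    apply: eq_bigr => k _; rewrite /B -!mulmxA; do 3 congr (_ *m _).
    by rewrite trmx_mul map_mxM.
  rewrite trace_prod_conjugates.
  rewrite (reindex (move_by sg)) /=; last first.
    exists (move_by sg^-1%g) => phi _; apply/ffunP => p; rewrite !ffunE.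
      by rewrite permK.
    by rewrite permKV.
  apply: eq_bigr => phi _; rewrite mulrA; congr (_ * _).
  have -> : \prod_p (-1) ^+ eps (move_by sg phi p) =
      \prod_k \prod_b (-1) ^+ eps (move_by sg phi (k, b)) :> C.
    by rewrite pair_bigA; apply: eq_bigr => -[].
  rewrite /edge_product -big_split; apply: eq_bigr => k _ /=.
  rewrite !ffunE /= signed_perm_mx_conj big_bool /= !ffunE.
  by rewrite mulrC; congr (_ * _); rewrite mulrC.
under [LHS]eq_bigr => eps _ do rewrite exchange_big /=.
rewrite [LHS]exchange_big /=; apply: eq_bigr => phi _.
under [LHS]eq_bigr => eps _ do rewrite -mulr_sumr.
rewrite -mulr_sumr; congr (_ * _).
by rewrite mulr_suml; apply: eq_bigr => eps _; rewrite mulr_sumr.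
Qed.

(** Maps with the same kernel differ by a permutation [tau], and translation by [tau] permutes the
    terms of the sum over [sg]. *)
Lemma kernel_weight_eq phi phi' : kernel phi = kernel phi' ->
  kernel_weight phi = kernel_weight phi'.
Proof.
move=> same; have [p q|tau tauE] := @perm_of_kernel _ phi phi'.
  by have /finset.setP/(_ (p, q)) := same; rewrite !inE.
rewrite /kernel_weight (reindex_inj (mulgI tau)) /=; apply: eq_bigr => sg _.
suff -> : move_by (tau * sg)%g phi = move_by sg phi' by [].
by apply/ffunP => p; rewrite !ffunE permM tauE.
Qed.

Lemma kernel_weight_singleton phi :
  ~~ no_singleton_block (kernel phi) -> kernel_weight phi = 0.
Proof.
rewrite negb_forall => /existsP[p]; rewrite negb_exists => /forallP single.
rewrite /kernel_weight big1 // => sg _; rewrite (signs_cancel (p0 := p)) ?mul0r //.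
move=> q qp; rewrite !ffunE (inj_eq perm_inj).
by have := single q; rewrite qp inE.
Qed.

Lemma kernel_weight_le (kappa : R) phi :
  (forall a b : 'I_n.+1 -> 'I_N,
    \sum_delta \prod_k modulus (link delta k (a k) (b k)) <= kappa) ->
  modulus (kernel_weight phi) <= N`!%:R * 2 ^+ N * kappa.
Proof.
move=> le_kappa; apply: le_trans (modulus_sum _ _) _.
apply: (@le_trans _ _ (\sum_(sg : 'S_N) 2 ^+ N * kappa)); last first.
  by rewrite sumr_const card_Sn -[leLHS]mulr_natl mulrA.
apply: ler_sum => sg _; rewrite modulusM ler_pM ?modulus_ge0 //.
  apply: le_trans (modulus_sum _ _) _.
  rewrite (eq_bigr (fun=> 1)) => [|eps _].
    by rewrite sumr_const card_ffun card_bool card_ord natrX.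
  rewrite modulus_prod big1 // => p _; apply: complexI.
  by rewrite modulusE normrX normrN1 expr1n.
apply: le_trans (modulus_sum _ _) _; apply: le_trans (le_kappa
  (fun k => move_by sg phi (k, true)) (fun k => move_by sg phi (ordS k, false))).
by apply: ler_sum => delta _; rewrite -modulus_prod.
Qed.

(** Index maps are grouped by kernel: the weight is constant on each group and vanishes in the
    presence of a singleton block. *)
Lemma sum_signed_perm_trace_le (kappa : R) (A : 'I_n.+1 -> 'M[C]_N) :
  0 <= kappa -> (forall k, \tr (A k) = 0) ->
  (forall a b : 'I_n.+1 -> 'I_N,
    \sum_delta \prod_k modulus (link delta k (a k) (b k)) <= kappa) ->
  modulus (\sum_eps \sum_sg \sum_delta \tr (\big[mulmx/1%:M]_k
    (V delta k *m signed_perm_mx eps sg *m A k *m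
      (V delta k *m signed_perm_mx eps sg)^t*))) <=
  #|{set point * point}|%:R ^+ #|[set: point * point]|.+2 *
  (N`!%:R * 2 ^+ N * kappa) * \prod_k hilbert_schmidt (A k).
Proof.
move=> kappa0 trA le_kappa; rewrite sum_signed_perm_trace.
rewrite (partition_big (@kernel _ _) xpredT) //=.
apply: le_trans (modulus_sum _ _) _.
set c := #|{set point * point}|; set m := #|[set: point * point]|.
set w := N`!%:R * 2 ^+ N * kappa.
(* The exponent is [m.+1] from [sum_kernel_bound], as the complement of [rho] has at most [m]
   elements, plus one for the number of kernels. *)
apply: (@le_trans _ _ (\sum_(rho : {set point * point})
    c%:R ^+ m.+1 * w * \prod_k hilbert_schmidt (A k))); last first.
  by rewrite sumr_const -[leLHS]mulr_natl [c%:R ^+ m.+2]exprS -!mulrA.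
have prod0 : 0 <= \prod_k hilbert_schmidt (A k).
  by apply: prodr_ge0 => k _; exact: sqrtr_ge0.
have w0 : 0 <= w by rewrite !mulr_ge0 ?exprn_ge0 ?ler0n.
apply: ler_sum => rho _.
have [nsing|sing] := boolP (no_singleton_block rho); last first.
  rewrite big1 ?modulus0 ?mulr_ge0 ?exprn_ge0 // => phi /eqP kphi.
  by rewrite kernel_weight_singleton ?mulr0 // kphi.
have [phi /eqP kphi|none] := pickP (fun phi => kernel phi == rho); last first.
  rewrite big1 => [|phi]; last by rewrite none.
  by rewrite modulus0 ?mulr_ge0 ?exprn_ge0.
rewrite (eq_bigr (fun phi' => edge_product (fun k => A k) phi' * kernel_weight phi)).
  rewrite -mulr_suml modulusM mulrAC ler_pM ?modulus_ge0 //; last first.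
    exact: kernel_weight_le.
  apply: sum_kernel_bound => //; rewrite ltnS; apply/subset_leq_card/finset.subsetT.
by move=> phi' /eqP kphi'; congr (_ * _); apply: kernel_weight_eq; rewrite kphi.
Qed.

End SignedPermutationAverage.

(** * Moments of the entries of V_k^* V_(k+1) *)

Section LinkMoments.
Variables (R : rcfType) (N : nat) (I : finType).
Variable F : 'M[R[i]]_N.
Local Notation signs := {ffun 'I_N -> bool}.
Local Notation sign_family := {ffun I -> signs}.
Implicit Types (delta : sign_family) (eta : signs) (o : option I).

Definition sign_diag_mx eta : 'M[R[i]]_N := \matrix_(i, j) ((-1) ^+ eta i * (i == j)%:R).

(** The trivial sign vector at [None] lets the factor without [D] be treated as one with [D] equal
    to the identity. *)
Definition sign_of delta o : signs := if o is Some i then delta i else [ffun=> false].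

Definition liberating_factor delta (j : option (option I)) : 'M[R[i]]_N :=
  if j is Some o then sign_diag_mx (sign_of delta o) *m F else 1%:M.

Hypothesis F_flat : forall i j, modulus (F i j) ^+ 2 = N%:R^-1.
Hypothesis N_gt0 : (0 < N)%N.

Definition link_entry delta (j j' : option (option I)) a b : R[i] :=
  ((liberating_factor delta j)^t* *m liberating_factor delta j') a b.

Lemma liberating_factorE delta o a b :
  liberating_factor delta (Some o) a b = (-1) ^+ sign_of delta o a * F a b.
Proof.
rewrite mxE (bigD1 a) //= big1 ?addr0 => [|c ca].
  by rewrite mxE eqxx mulr1.
by rewrite mxE eq_sym (negbTE ca) mulr0 mul0r.
Qed.

Lemma modulus_signM (b : bool) (z : R[i]) : modulus ((-1) ^+ b * z) = modulus z.
Proof. by rewrite /modulus normrMsign. Qed.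

Lemma modulus_conj (z : R[i]) : modulus (z^*) = modulus z.
Proof. by rewrite /modulus norm_conjC. Qed.

Lemma link_entryE delta o o' a b : link_entry delta (Some o) (Some o') a b =
  \sum_c (-1) ^+ sign_of delta o c * (-1) ^+ sign_of delta o' c *
    ((F c a)^* * F c b).
Proof.
rewrite /link_entry mxE; apply: eq_bigr => c _; rewrite 2!mxE !liberating_factorE.
by rewrite rmorphM rmorph_sign /=; ring.
Qed.

Definition translate (i : I) eta delta : sign_family :=
  [ffun k => if k == i then [ffun c => eta c (+) delta i c] else delta k].

Lemma translateK i eta : involutive (translate i eta).
Proof.
move=> delta; apply/ffunP => k; rewrite !ffunE; case: eqP => [->|//].
by apply/ffunP => c; rewrite !ffunE eqxx !ffunE addKb.
Qed.

Lemma sign_of_translate i eta delta o c :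
  (-1) ^+ sign_of (translate i eta delta) o c =
  (if o == Some i then (-1) ^+ eta c else 1) * (-1) ^+ sign_of delta o c :> R[i].
Proof.
case: o => [k|] /=; last by rewrite mul1r.
rewrite ffunE (inj_eq (@Some_inj _)); case: eqP => [->|_]; last by rewrite mul1r.
by rewrite ffunE signr_addb.
Qed.

(* Translating the i-th sign vector by eta permutes the families delta, so the
   moment can first be averaged over eta, where Khinchine's inequality applies. *)
Lemma link_moment_translate i o o' a b (p : nat) :
  (forall eta delta,
    link_entry (translate i eta delta) (Some o) (Some o') a b =
    \sum_c (-1) ^+ eta c * ((-1) ^+ sign_of delta o c *
      (-1) ^+ sign_of delta o' c * ((F c a)^* * F c b))) ->
  \sum_delta (N%:R * modulus (link_entry delta (Some o) (Some o') a b) ^+ 2) ^+ p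
  <= #|{: sign_family}|%:R * (4 * p).+1%:R ^+ p.
Proof.
move=> shift; have N0 : (N%:R : R) != 0 by rewrite pnatr_eq0 -lt0n.
have two0 : 0 < 2 ^+ N :> R by exact: exprn_gt0.
rewrite -(ler_pM2l two0); set f := BIG_F.
have -> : 2 ^+ N * \sum_delta f delta =
    \sum_delta \sum_(eta : signs) f (translate i eta delta).
  rewrite exchange_big /= [RHS](eq_bigr (fun=> \sum_delta f delta)) => [|eta _].
    by rewrite sumr_const card_ffun card_bool card_ord -[RHS]mulr_natl natrX.
  by rewrite [RHS](reindex_inj (inv_inj (translateK i eta))).
apply: (@le_trans _ _ (\sum_(delta : sign_family) 2 ^+ N * (4 * p).+1%:R ^+ p)).
  apply: ler_sum => delta _.
  (* Flatness of [F] gives each product of two entries modulus [1 / N], so the factor [N] makes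
     [u c] unimodular, as Khinchine requires. *)
  pose u c : R[i] := N%:R * ((-1) ^+ sign_of delta o c *
    (-1) ^+ sign_of delta o' c * ((F c a)^* * F c b)).
  have u1 c : modulus (u c) = 1.
    rewrite /u modulusM -mulrA !modulus_signM modulusM modulus_conj.
    have modF x y : modulus (F x y) = Num.sqrt N%:R^-1.
      by rewrite -(F_flat x y) sqrtr_sqr ger0_norm ?modulus_ge0.
    rewrite !modF -expr2 sqr_sqrtr ?invr_ge0 ?ler0n //.
    by rewrite modulus_nat mulfV.
  have fE eta : f (translate i eta delta) =
      N%:R^-1 ^+ p * (modulus (\sum_c (-1) ^+ eta c * u c) ^+ 2) ^+ p.
    rewrite /f shift -exprMn; congr (_ ^+ p).
    have -> : \sum_c (-1) ^+ eta c * u c = N%:R * \sum_c (-1) ^+ eta c *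
        ((-1) ^+ sign_of delta o c * (-1) ^+ sign_of delta o' c *
          ((F c a)^* * F c b)).
      by rewrite mulr_sumr; apply: eq_bigr => c _; rewrite /u mulrCA.
    by rewrite modulusM modulus_nat exprMn [N%:R ^+ 2]expr2 !mulrA mulVf // mul1r.
  under eq_bigr do rewrite fE.
  rewrite -mulr_sumr; apply: le_trans (ler_wpM2l _ (Khinchine p u1)) _.
    by rewrite exprn_ge0 // invr_ge0.
  by rewrite mulrCA -exprMn mulrCA mulVf // mulr1.
by rewrite sumr_const -[leLHS]mulr_natl mulrCA.
Qed.

(** If one index is [None], the entry is an entry of [F] up to sign and conjugation, with constant
    modulus. Otherwise some [Some i] stands on exactly one side, and translation by [eta] gives each
    summand exactly one new sign. *)
Lemma link_moment_le j j' a b (p : nat) : j != j' ->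
  \sum_delta (N%:R * modulus (link_entry delta j j' a b) ^+ 2) ^+ p
  <= #|{: sign_family}|%:R * (4 * p).+1%:R ^+ p.
Proof.
have N0 : (N%:R : R) != 0 by rewrite pnatr_eq0 -lt0n.
have deterministic : (forall delta,
    modulus (link_entry delta j j' a b) ^+ 2 = N%:R^-1) ->
    \sum_delta (N%:R * modulus (link_entry delta j j' a b) ^+ 2) ^+ p
    <= #|{: sign_family}|%:R * (4 * p).+1%:R ^+ p.
  move=> flat; rewrite (eq_bigr (fun=> 1)) => [|delta _]; last first.
    by rewrite flat mulfV // expr1n.
  rewrite sumr_const ler_peMr ?ler0n //; apply: exprn_ege1.
  by rewrite ler1n.
case: j j' deterministic => [k1|] [k2|] deterministic jj' //.
- have k12 : k1 != k2 by [].
  case: k1 k12 {deterministic jj'} => [i|] k12.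
    apply: (link_moment_translate (i := i)) => eta delta; rewrite link_entryE.
    apply: eq_bigr => c _; rewrite !sign_of_translate eqxx eq_sym.
    by rewrite (negbTE k12) mul1r !mulrA.
  case: k2 k12 => [i|//] k12.
  apply: (link_moment_translate (i := i)) => eta delta; rewrite link_entryE.
  apply: eq_bigr => c _; rewrite !sign_of_translate eqxx (negbTE k12).
  by rewrite mul1r; ring.
- apply: deterministic => delta; rewrite /link_entry mulmx1 2!mxE.
  by rewrite modulus_conj liberating_factorE modulus_signM.
- apply: deterministic => delta; rewrite /link_entry [liberating_factor _ None]/=.
  by rewrite trmx1 map_mx1 mul1mx liberating_factorE modulus_signM.
Qed.

(** A crude substitute for Hölder: the product is at most a power of the largest factor. It reduces
    mixed moments to even moments of single entries. *)
Lemma prod_le_sum_powers n (y : 'I_n.+1 -> R) : (forall k, 0 <= y k) ->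
  \prod_k y k <= \sum_k (1 + (y k ^+ 2) ^+ n.+1).
Proof.
move=> y0; have [m _ ymax] := arg_maxP y (erefl true : xpredT ord0).
apply: (@le_trans _ _ (y m ^+ n.+1)).
  rewrite -[n.+1 in leRHS]card_ord -prodr_const; apply: ler_prod => k _.
  by rewrite y0; exact: ymax.
apply: (@le_trans _ _ (1 + (y m ^+ 2) ^+ n.+1)).
  rewrite exprAC; set x := y m ^+ n.+1.
  have := sqr_ge0 (x - 1); have := sqr_ge0 x; nra.
rewrite (bigD1 m) //= lerDl; apply: sumr_ge0 => k _.
by rewrite addr_ge0 // exprn_ge0 // sqr_ge0.
Qed.

(** Multiplied by the square root of [N], each entry has moments bounded independently of [N];
    undoing this produces the denominator. *)
Lemma link_product_moment_le n (ix : 'I_n.+1 -> option (option I))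
    (a b : 'I_n.+1 -> 'I_N) :
  (forall k, ix k != ix (ordS k)) ->
  \sum_delta \prod_k modulus
    (link (fun delta k => liberating_factor delta (ix k)) delta k (a k) (b k))
  <= #|{: sign_family}|%:R * (n.+1%:R * (1 + (4 * n.+1).+1%:R ^+ n.+1)) /
     Num.sqrt N%:R ^+ n.+1.
Proof.
move=> ixS; have sqrtN : 0 < Num.sqrt (N%:R : R) by rewrite sqrtr_gt0 ltr0n.
rewrite ler_pdivlMr ?exprn_gt0 // mulr_suml.
pose y delta k := Num.sqrt N%:R * modulus (link_entry delta (ix k) (ix (ordS k)) (a k) (b k)).
apply: (@le_trans _ _ (\sum_delta \sum_k (1 + (y delta k ^+ 2) ^+ n.+1))).
  apply: ler_sum => delta _; apply: le_trans (prod_le_sum_powers _); last first.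
    by move=> k; rewrite mulr_ge0 ?modulus_ge0 // ltW.
  have -> : Num.sqrt N%:R ^+ n.+1 = \prod_(k < n.+1) Num.sqrt N%:R :> R.
    by rewrite prodr_const card_ord.
  rewrite -big_split /=.
  by apply: ler_prod => k _; rewrite mulr_ge0 ?modulus_ge0 ?(ltW sqrtN) //= mulrC.
rewrite exchange_big /=.
apply: (@le_trans _ _ (\sum_(k < n.+1)
    #|{: sign_family}|%:R * (1 + (4 * n.+1).+1%:R ^+ n.+1))); last first.
  by rewrite sumr_const card_ord -[leLHS]mulr_natl mulrCA.
apply: ler_sum => k _; rewrite big_split /= sumr_const mulrDr mulr1 lerD2l.
apply: le_trans (link_moment_le _ _ _ (ixS k)).
by apply: ler_sum => delta _; rewrite /y [(_ * _) ^+ 2]exprMn sqr_sqrtr ?ler0n.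
Qed.

End LinkMoments.

(** * Singular values *)

Section SingularValues.
Variables (R : realType) (N : nat) (A : 'M[R[i]]_N).
Local Notation B := (A^t* *m A).
Local Notation P := (spectralmx B).
Local Notation lambda := (spectral_diag B).

Lemma gram_normal : B \is normalmx.
Proof. by apply/normalmxP; rewrite trmx_mul map_mxM trmxCK. Qed.

Lemma spectral_gram : P *m B *m P^t* = diag_mx lambda.
Proof.
have /orthomx_spectralP BE := gram_normal; have Pu := spectral_unitarymx B.
rewrite [in X in _ *m X *m _]BE -(invmx_unitary Pu) !mulmxA mulmxV ?spectral_unit //.
by rewrite mul1mx mulmxK ?spectral_unit.
Qed.

(** The eigenvalue is the squared norm of a column of [A *m P^t*]. *)
Lemma gram_eigenvalue_ge0 i : 0 <= lambda 0 i.
Proof.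
have -> : lambda 0 i = ((A *m P^t*)^t* *m (A *m P^t*)) i i.
  by rewrite trmx_mul map_mxM trmxCK !mulmxA -[_ *m A^t* *m A]mulmxA spectral_gram
    mxE eqxx.
by rewrite mxE sumr_ge0 // => k _; rewrite 2!mxE mulrC mul_conjC_ge0.
Qed.

Lemma spectral_gram_eigenvalue i : eigenvalue B (lambda 0 i).
Proof.
apply/eigenvalueP; exists (row i P).
  have Pu := spectral_unitarymx B.
  have e : P *m B = diag_mx lambda *m P.
    by rewrite -spectral_gram -(invmx_unitary Pu) mulmxKV ?spectral_unit.
  by rewrite -row_mul e row_mul row_diag_mx -scalemxAl -rowE.
apply/eqP => row0; have /row_unitarymxP/(_ i i) := spectral_unitarymx B.
by rewrite row0 eqxx linear0l => /eqP; rewrite eq_sym oner_eq0.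
Qed.

(** In the spectral basis an eigenvector becomes an eigenvector [w] of a diagonal matrix, and any
    nonzero coordinate of [w] locates [a]. *)
Lemma gram_eigenvalue_spectral a : eigenvalue B a -> exists i, a = lambda 0 i.
Proof.
move=> /eigenvalueP[v vB v0]; pose w := v *m P^t*.
have Pu := spectral_unitarymx B.
have Pw : w *m P = v by rewrite /w -(invmx_unitary Pu) mulmxKV ?spectral_unit.
have wl : w *m diag_mx lambda = a *: w.
  have -> : w *m diag_mx lambda = w *m P *m B *m P^t*.
    by rewrite -spectral_gram !mulmxA.
  by rewrite Pw vB -scalemxAl.
have [i wi|w0] := pickP (fun i => w 0 i != 0); last first.
  case/eqP: v0; rewrite -Pw; suff -> : w = 0 by rewrite mul0mx.
  by apply/rowP => i; rewrite [RHS]mxE; apply/eqP/negbFE/w0.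
exists i; have /rowP/(_ i) := wl; rewrite mul_mx_diag mxE [RHS]mxE mulrC.
by move/(mulIf wi).
Qed.

(** The square of a singular value is at most the sum of the eigenvalues, and [s <= 1 + s ^+ 2].
    Boundedness makes [sup] a genuine upper bound. *)
Lemma singular_values_bounded : has_ubound (singular_values A).
Proof.
exists (1 + complex.Re (\sum_i lambda 0 i)) => s [s0 /gram_eigenvalue_spectral[i e]].
have : (s ^+ 2)%:C <= \sum_i lambda 0 i.
  by rewrite e (bigD1 i) //= lerDl sumr_ge0 // => j _; exact: gram_eigenvalue_ge0.
rewrite lecE /= => /andP[_ le]; apply: le_trans (lerD (lexx 1) le).
have := sqr_ge0 (s - 1); have := sqr_ge0 s; nra.
Qed.

Lemma gram_eigenvalue_le i : lambda 0 i <= (max_singular_value A ^+ 2)%:C.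
Proof.
have l0 := gram_eigenvalue_ge0 i; pose s := Num.sqrt (complex.Re (lambda 0 i)).
have re0 : 0 <= complex.Re (lambda 0 i).
  by move: l0; rewrite lecE /= => /andP[].
have sE : lambda 0 i = (s ^+ 2)%:C.
  by rewrite sqr_sqrtr // RRe_real // ger0_real.
have s0 : 0 <= s by exact: sqrtr_ge0.
have sS : singular_values A s by split; rewrite -?sE //; exact: spectral_gram_eigenvalue.
rewrite sE lecR lerXn2r ?nnegrE //.
  by apply: le_trans s0 _; apply: ub_le_sup sS; exact: singular_values_bounded.
by apply: ub_le_sup sS; exact: singular_values_bounded.
Qed.

Lemma max_singular_value_ge0 : 0 <= max_singular_value A.
Proof.
(* The supremum of the empty set is 0 by convention. *)
rewrite /max_singular_value; have [->|/set0P[s sS]] := eqVneq (singular_values A) set0.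
  by rewrite sup0.
have [s0 _] := sS; apply: le_trans s0 _.
by apply: ub_le_sup sS; exact: singular_values_bounded.
Qed.

(** The squared Hilbert-Schmidt norm is the trace of [B], a sum of [N] eigenvalues. *)
Lemma hilbert_schmidt_le :
  hilbert_schmidt (fun i j => A i j) <= Num.sqrt N%:R * max_singular_value A.
Proof.
rewrite -[max_singular_value A]ger0_norm ?max_singular_value_ge0 //.
rewrite -sqrtr_sqr -sqrtrM ?ler0n // ler_wsqrtr // -lecR.
have -> : (\sum_x \sum_y modulus (A x y) ^+ 2)%:C = \sum_i lambda 0 i.
  rewrite -mxtrace_diag -spectral_gram mxtrace_mulC.
  rewrite -(invmx_unitary (spectral_unitarymx B)) mulKmx ?spectral_unit //.
  rewrite exchange_big rmorph_sum; apply: eq_bigr => y _ /=.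
  rewrite rmorph_sum mxE; apply: eq_bigr => x _ /=.
  by rewrite 2!mxE rmorphXn /= modulusE normCK mulrC.
apply: (@le_trans _ _ (\sum_(i < N) (max_singular_value A ^+ 2)%:C)).
  by apply: ler_sum => i _; exact: gram_eigenvalue_le.
by rewrite sumr_const card_ord -[leLHS]mulr_natl [leRHS]rmorphM rmorph_nat.
Qed.

End SingularValues.

(** * The joint law of the random matrices *)

Local Open Scope classical_set_scope.
Local Open Scope ring_scope.

Section FiniteValued.
Context {R : realType} {d : measure_display} {T : measurableType d}.
Variables (P : probability T R) (Omega : finType) (code : T -> Omega).
Hypothesis measurable_fiber : forall w, measurable (code @^-1` [set w]).

Lemma measurable_fun_code (f : Omega -> R) :
  measurable_fun [set: T] (fun t => f (code t)).
Proof.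
move=> _ B _; rewrite setTI.
have -> : (fun t => f (code t)) @^-1` B =
    \bigcup_(w in [set w | B (f w)]) code @^-1` [set w].
  by apply/seteqP; split => [t Bt|t [w /= Bw codet]]; [exists (code t)|rewrite /= codet].
by apply: fin_bigcup_measurable => //; exact: finite_finset.
Qed.

Lemma random_matrix_code N (M : Omega -> 'M[R[i]]_N) :
  random_matrix (fun t => M (code t)).
Proof.
by move=> i j; split; [exact: (measurable_fun_code (fun w => complex.Re (M w i j)))
  | exact: (measurable_fun_code (fun w => complex.Im (M w i j)))].
Qed.

Variable c : R.
Hypothesis uniform_fiber : forall w, P (code @^-1` [set w]) = c%:E.

(** The variable is a finite combination of indicators of fibers, each of probability [c]. *)
Lemma expectation_code (f : Omega -> R) :
  ('E_P[fun t => f (code t)] = (c * \sum_w f w)%:E)%E.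
Proof.
rewrite unlock.
pose h w t : \bar R := ((f w)%:E * (\1_(code @^-1` [set w]) t)%:E)%E.
rewrite (eq_integral (fun t => \sum_w h w t)%E) => [|t _]; last first.
  rewrite (bigD1 (code t)) //= big1 ?adde0 => [|w wt]; rewrite /h indicE.
    by rewrite mem_set // mule1.
  by rewrite memNset ?mule0 // => /= e; rewrite -e eqxx in wt.
have int_ind w : P.-integrable [set: T] (fun t => (\1_(code @^-1` [set w]) t)%:E).
  exact: integrable_indic.
rewrite integral_sum // => [|w]; last exact: integrableZl.
rewrite mulr_sumr -sumEFin; apply: eq_bigr => w _.
rewrite integralZl // integral_indic // setIT mulrC EFinM.
by congr (_ * _)%E; exact: uniform_fiber.
Qed.

(** Total mass one, that is, the expectation of the constant 1, forces [c] to be the inverse of the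
    number of outcomes. *)
Lemma complex_expectation_code (g : Omega -> R[i]) :
  complex_expectation P (fun t => g (code t)) = #|Omega|%:R^-1 * \sum_w g w.
Proof.
have mass : c * #|Omega|%:R = 1.
  have := expectation_code (fun=> 1).
  rewrite (expectation_cst P 1) sumr_const => -[e]; exact: esym.
have cE : c%:C = #|Omega|%:R^-1 :> R[i].
  have Om0 : #|Omega|%:R != 0 :> R[i].
    rewrite pnatr_eq0; apply: contra_eq_neq mass => ->.
    by rewrite mulr0 eq_sym oner_eq0.
  apply: (mulIf Om0); rewrite mulVf // -(rmorph_nat (real_complex R)).
  by rewrite -rmorphM /= mass.
rewrite /complex_expectation (expectation_code (fun w => complex.Re (g w))).
rewrite (expectation_code (fun w => complex.Im (g w))) /= -cE.
have ReE : complex.Re (\sum_w g w) = \sum_w complex.Re (g w).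
  by elim/big_rec2: _ => // w x y _ <-; case: (g w) y => [? ?] [? ?].
have ImE : complex.Im (\sum_w g w) = \sum_w complex.Im (g w).
  by elim/big_rec2: _ => // w x y _ <-; case: (g w) y => [? ?] [? ?].
case: (\sum_w g w) ReE ImE => a b /= -> ->; apply/eqP.
by rewrite eq_complex /= !mul0r subr0 addr0 !eqxx.
Qed.

End FiniteValued.

Section SignedPermutations.
Variables (R : realType) (N : nat).
Implicit Types (eps eta : {ffun 'I_N -> bool}) (sg : 'S_N).

Lemma signed_perm_mxP (w : 'M[R[i]]_N) : signed_permutation_matrices w ->
  exists eps sg, w = signed_perm_mx R eps sg.
Proof.
move=> [e [sg [esign wE]]]; exists [ffun i => e i == -1], sg.
apply/matrixP => i j; rewrite mxE wE ffunE; congr (_ * _).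
case: (esign i) => -> //; last by rewrite eqxx.
have /negbTE -> // : (1 : R[i]) != -1.
by rewrite -subr_eq0 opprK -mulr2n pnatr_eq0.
Qed.

Lemma signed_perm_mx_in eps sg :
  signed_permutation_matrices (signed_perm_mx R eps sg).
Proof.
exists (fun i => (-1) ^+ eps i), sg; split=> [i|i j]; last by rewrite mxE.
by case: (eps i); [right|left].
Qed.

Lemma signed_perm_mx_inj eps sg eps' sg' :
  signed_perm_mx R eps sg = signed_perm_mx R eps' sg' -> eps = eps' /\ sg = sg'.
Proof.
move=> /matrixP e; have sgE : sg = sg'.
  apply/permP => j; apply/eqP; have := e (sg j) j; rewrite !mxE eqxx mulr1.
  by case: (sg j == sg' j) => // /eqP; rewrite mulr0 signr_eq0.
split=> //; apply/ffunP => i; have := e i (sg^-1 i)%g.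
by rewrite !mxE -sgE permKV eqxx !mulr1 => /signr_inj.
Qed.

Lemma sign_diag_mxE eta : sign_diag_mx R eta = signed_perm_mx R eta 1.
Proof. by apply/matrixP => i j; rewrite !mxE perm1. Qed.

Lemma sign_diag_mxP (w : 'M[R[i]]_N) : diag_signed_permutation_matrices w ->
  exists eta, w = sign_diag_mx R eta.
Proof.
move=> [/signed_perm_mxP[eta [sg ->]] /is_diag_mxP diag]; exists eta.
rewrite sign_diag_mxE; congr signed_perm_mx; apply/permP => j; rewrite perm1.
apply/eqP/negPn/negP => ne; have := diag (sg j) j ne; rewrite mxE eqxx mulr1.
by move/eqP; rewrite signr_eq0.
Qed.

Lemma sign_diag_mx_in eta :
  diag_signed_permutation_matrices (sign_diag_mx R eta).
Proof.
split; first by rewrite sign_diag_mxE; exact: signed_perm_mx_in.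
apply/is_diag_mxP => i j ij; rewrite mxE.
by have /negbTE -> : i != j by []; rewrite mulr0.
Qed.

Lemma sign_diag_mx_inj : injective (@sign_diag_mx R N).
Proof. by move=> eta eta'; rewrite !sign_diag_mxE => /signed_perm_mx_inj[]. Qed.

(** This is the conjugation formula applied to the identity matrix. *)
Lemma signed_perm_mx_unitary eps sg : signed_perm_mx R eps sg \is unitarymx.
Proof.
apply/unitarymxP/matrixP => a b.
rewrite -[a](permKV sg) -[b](permKV sg) -[X in X *m _]mulmx1 signed_perm_mx_conj.
rewrite !mxE (inj_eq perm_inj) !permKV; case: eqP => [->|_]; last first.
  by rewrite mulr0.
by rewrite mulr1 -expr2 sqrr_sign.
Qed.

End SignedPermutations.

Section JointLaw.
Context {R : realType} {d : measure_display} {T : measurableType d}.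
Variables (P : probability T R) (N : nat).

(** A fiber is a finite intersection of conditions on the entries. Independence, stated for
    generated sigma-algebras, thereby applies to fibers. *)
Lemma fiber_in_sigma_of (X : T -> 'M[R[i]]_N) (w : 'M[R[i]]_N) :
  sigma_of X (X @^-1` [set w]).
Proof.
have -> : X @^-1` [set w] = \bigcap_(p in [set: 'I_N * 'I_N])
    ((fun t => complex.Re (X t p.1 p.2)) @^-1` [set complex.Re (w p.1 p.2)] `&`
     (fun t => complex.Im (X t p.1 p.2)) @^-1` [set complex.Im (w p.1 p.2)]).
  apply/seteqP; split => [t /= e p _|t /= e]; first by rewrite /= e.
  apply/matrixP => i j.
  have [/= re im] := e (i, j) I.
  by case: (X t i j) (w i j) re im => [a b] [a' b'] /= -> ->.
rewrite /sigma_of; set G := (X in <<s X >>).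
apply: (@fin_bigcap_measurable _ (g_sigma_algebraType G)) => [|p _].
  exact: finite_finset.
apply: (@measurableI _ (g_sigma_algebraType G)); apply: sub_sigma_algebra.
  by exists p.1, p.2, [set complex.Re (w p.1 p.2)]; split; last left.
by exists p.1, p.2, [set complex.Im (w p.1 p.2)]; split; last right.
Qed.

Lemma sigma_of_measurable (X : T -> 'M[R[i]]_N) E :
  random_matrix X -> sigma_of X E -> measurable E.
Proof.
move=> mX; apply: smallest_sub; first exact: sigma_algebra_measurable.
move=> _ [i [j [B [mB [->|->]]]]]; have [mRe mIm] := mX i j.
  by rewrite -[X in measurable X]setTI; exact: mRe.
by rewrite -[X in measurable X]setTI; exact: mIm.
Qed.

Variable I : finType.
Variables (W : T -> 'M[R[i]]_N) (D : I -> T -> 'M[R[i]]_N).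
Hypothesis W_uniform :
  uniformly_distributed P (@signed_permutation_matrices R N) W.
Hypothesis D_uniform : forall i,
  uniformly_distributed P (@diag_signed_permutation_matrices R N) (D i).
Hypothesis D_independent : mutually_independent P D.
Hypothesis D_W_independent :
  independent_classes P (sigma_of_family D) (sigma_of W).

Local Notation signs := {ffun 'I_N -> bool}.
Local Notation outcome := (signs * 'S_N * {ffun I -> signs})%type.

(** Each sample point is coded by the signs and permutation it realises. A fiber of the code is an
    intersection of fibers of [W] and of the [D i], so independence and uniformity give all fibers
    the same probability. *)
Lemma joint_code : exists code : T -> outcome,
  [/\ forall t, W t = signed_perm_mx R (code t).1.1 (code t).1.2,
      forall t i, D i t = sign_diag_mx R ((code t).2 i),
      forall w, measurable (code @^-1` [set w]) &
      exists c : R, forall w, P (code @^-1` [set w]) = c%:E].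
Proof.
have [_ mW WS PW] := W_uniform.
have /choice[cW cWE] : forall t, exists es : signs * 'S_N,
    W t = signed_perm_mx R es.1 es.2.
  by move=> t; have [e [s]] := signed_perm_mxP (WS t); exists (e, s).
have /choice[cD cDE] : forall t, exists delta : {ffun I -> signs},
    forall i, D i t = sign_diag_mx R (delta i).
  move=> t; have /choice[f fE] : forall i, exists eta, D i t = sign_diag_mx R eta.
    by move=> i; have [_ _ DS _] := D_uniform i; exact: sign_diag_mxP (DS t).
  by exists [ffun i => f i] => i; rewrite ffunE.
pose code t : outcome := (cW t, cD t).
pose DE (w : outcome) i := D i @^-1` [set sign_diag_mx R (w.2 i)].
pose WE (w : outcome) := W @^-1` [set signed_perm_mx R w.1.1 w.1.2].
have fiberE w : code @^-1` [set w] =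
    (\bigcap_(i in [set` [set: I]%SET]) DE w i) `&` WE w.
  apply/seteqP; split => [t /= <-|t /= [De We]].
    by split; [move=> i _; exact: cDE | exact: cWE].
  case: w De We => [[e s] delta] De; rewrite /WE /= cWE => /signed_perm_mx_inj[].
  rewrite /code => <- <-; rewrite -surjective_pairing; congr pair.
  apply/ffunP => i; apply: (@sign_diag_mx_inj R); rewrite -cDE; apply: De.
  by rewrite /= inE.
have mDE w i : measurable (DE w i).
  have [_ mD _ _] := D_uniform i.
  by apply: (sigma_of_measurable mD); exact: fiber_in_sigma_of.
exists code; split=> //.
- move=> w; rewrite fiberE; apply: measurableI.
    by apply: fin_bigcap_measurable => [|i _]; [exact: finite_finset | exact: mDE].
  by apply: (sigma_of_measurable mW); exact: fiber_in_sigma_of.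
(* These cardinals stay uncomputed, since total mass one determines the common probability of the
   fibers. *)
pose pD := #|` fset_set (@diag_signed_permutation_matrices R N)|%:R^-1 : R.
pose pW := #|` fset_set (@signed_permutation_matrices R N)|%:R^-1 : R.
exists (pD ^+ #|I| * pW) => w; rewrite fiberE D_W_independent; first last.
- exact: fiber_in_sigma_of.
- rewrite /sigma_of_family; set G := (X in <<s X >>).
  apply: (@fin_bigcap_measurable _ (g_sigma_algebraType G)) => [|i _].
    exact: finite_finset.
  apply: sub_sigma_algebra; exists i => //; exact: fiber_in_sigma_of.
rewrite EFinM; congr (_ * _)%E; last by apply: PW; exact: signed_perm_mx_in.
rewrite D_independent => [|i _]; last exact: fiber_in_sigma_of.
rewrite (eq_bigr (fun=> pD%:E)) => [|i _]; last first.
  by have [_ _ _ ->] := D_uniform i; last exact: sign_diag_mx_in.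
have -> : (\prod_(i in [set: I]%SET) pD%:E = (\prod_(i in [set: I]%SET) pD)%:E)%E.
  by apply/esym/(big_morph EFin).
by rewrite prodr_const cardsT.
Qed.

End JointLaw.

Lemma hadamard_entry_flat (R : realType) N (H : 'M[R[i]]_N) : (0 < N)%N ->
  is_complex_hadamard H -> forall i j, modulus (div_sqrt_dim H i j) ^+ 2 = N%:R^-1.
Proof.
move=> N0 [_ flat] i j; apply: complexI.
rewrite rmorphXn /= modulusE mxE normrM flat mulr1 -normrX exprVn sqrtCK.
by rewrite ger0_norm ?invr_ge0 ?ler0n // fmorphV /= rmorph_nat.
Qed.

Lemma sign_diag_mx0 (R : realType) N : sign_diag_mx R [ffun=> false] = 1%:M :> 'M[R[i]]_N.
Proof. by apply/matrixP => i j; rewrite !mxE ffunE expr0 mul1r. Qed.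

(* The index set is I with two extra points: None for W and Some None for
   (H / sqrt N) W, while Some (Some i) stands for D_i (H / sqrt N) W. *)
Theorem corollary3p2 (R : realType) (I : finType)
    (d : nat -> measure_display) (T : forall N, measurableType (d N))
    (P : forall N, probability (T N) R)
    (H : forall N, 'M[R[i]]_N)
    (W : forall N, T N -> 'M[R[i]]_N)
    (D : forall N, I -> T N -> 'M[R[i]]_N)
    (H_hadamard : forall N, (0 < N)%N -> is_complex_hadamard (H N))
    (W_uniform : forall N, (0 < N)%N ->
       uniformly_distributed (P N) (@signed_permutation_matrices R N) (W N))
    (D_uniform : forall N, (0 < N)%N -> forall i : I,
       uniformly_distributed (P N) (@diag_signed_permutation_matrices R N)
         (D N i))
    (D_independent : forall N, (0 < N)%N -> mutually_independent (P N) (D N))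
    (D_W_independent : forall N, (0 < N)%N ->
       independent_classes (P N) (sigma_of_family (D N)) (sigma_of (W N))) :
  asymptotically_liberating P
    (fun N (j : option (option I)) (t : T N) =>
       match j with
       | None => W N t
       | Some None => div_sqrt_dim (H N) *m W N t
       | Some (Some i) => D N i t *m div_sqrt_dim (H N) *m W N t
       end).
Proof.
(* Each unitary is written as a liberating factor times a signed permutation, both read off one
   uniform outcome in a finite set. *)
have model N : (0 < N)%N -> exists code : T N ->
    {ffun 'I_N -> bool} * 'S_N * {ffun I -> {ffun 'I_N -> bool}},
  [/\ forall j t, match j with
        | None => W N t
        | Some None => div_sqrt_dim (H N) *m W N t
        | Some (Some i) => D N i t *m div_sqrt_dim (H N) *m W N t
        end = liberating_factor (div_sqrt_dim (H N)) (code t).2 j *m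
              signed_perm_mx R (code t).1.1 (code t).1.2,
      forall w, measurable (code @^-1` [set w]) &
      exists c : R, forall w, P N (code @^-1` [set w]) = c%:E].
  move=> N0; have [code [WE DE mcode unif]] := joint_code (W_uniform N N0)
    (D_uniform N N0) (D_independent N N0) (D_W_independent N N0).
  exists code; split; [|exact: mcode|exact: unif].
  case=> [[i|]|] t; rewrite WE ?DE /liberating_factor /=; first by [].
    by rewrite sign_diag_mx0 mul1mx.
  by rewrite mul1mx.
split=> [N N0 j|l ix l2 ixS].
  have [code [UE mcode _]] := model N N0.
  split=> [|t].
    have -> : (fun t => match j with
        | None => W N t
        | Some None => div_sqrt_dim (H N) *m W N t
        | Some (Some i) => D N i t *m div_sqrt_dim (H N) *m W N t
        end) = (fun t => liberating_factor (div_sqrt_dim (H N)) (code t).2 j *m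
              signed_perm_mx R (code t).1.1 (code t).1.2).
      by apply/funext => t; exact: UE.
    exact: (random_matrix_code mcode (fun w =>
      liberating_factor (div_sqrt_dim (H N)) w.2 j *m
      signed_perm_mx R w.1.1 w.1.2)).
  rewrite UE; apply: mul_unitarymx; last exact: signed_perm_mx_unitary.
  have [HU _] := H_hadamard N N0.
  case: j {UE} => [k|] /=; last by apply/unitarymxP; rewrite trmx1 map_mx1 mulmx1.
  apply: mul_unitarymx; last exact: HU.
  by rewrite sign_diag_mxE; exact: signed_perm_mx_unitary.
case: l ix l2 ixS => // n ix _ ixS.
pose point := ('I_n.+1 * bool)%type.
pose moment : R := n.+1%:R * (1 + (4 * n.+1).+1%:R ^+ n.+1).
(* The first factor counts kernels along the induction, the second bounds the normalised moments;
   both depend only on the word length. *)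
exists (#|{set point * point}|%:R ^+ #|[set: point * point]%SET|.+2 * moment).
move=> N N0 A trA; have [code [UE mcode [c unif]]] := model N N0.
set F := div_sqrt_dim (H N) in UE *.
pose V (delta : {ffun I -> {ffun 'I_N -> bool}}) k := liberating_factor F delta (ix k).
pose g (w : {ffun 'I_N -> bool} * 'S_N * {ffun I -> {ffun 'I_N -> bool}}) : R[i] :=
  \tr (\big[mulmx/1%:M]_k (V w.2 k *m signed_perm_mx R w.1.1 w.1.2 *m A k *m
      (V w.2 k *m signed_perm_mx R w.1.1 w.1.2)^t*)).
set Z := (X in complex_expectation _ X).
have -> : Z = (fun t => g (code t)).
  apply/funext => t; rewrite /Z /g; congr (\tr _); apply: eq_bigr => k _.
  by rewrite UE.
rewrite (complex_expectation_code mcode unif) -modulusE lecR modulusM.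
set S := \sum_w g w.
have SE : S = \sum_eps \sum_sg \sum_delta \tr (\big[mulmx/1%:M]_k
    (V delta k *m signed_perm_mx R eps sg *m A k *m
      (V delta k *m signed_perm_mx R eps sg)^t*)).
  by rewrite [RHS]pair_bigA [RHS]pair_bigA; apply: eq_bigr => -[[]].
pose kappa : R := #|{: {ffun I -> {ffun 'I_N -> bool}}}|%:R * moment /
  Num.sqrt N%:R ^+ n.+1.
have sqrtN : 0 < Num.sqrt (N%:R : R) by rewrite sqrtr_gt0 ltr0n.
have moment0 : 0 <= moment by rewrite mulr_ge0 ?addr_ge0 ?exprn_ge0.
have kappa0 : 0 <= kappa.
  by rewrite mulr_ge0 ?invr_ge0 ?exprn_ge0 ?(ltW sqrtN) // mulr_ge0.
have le_kappa (a b : 'I_n.+1 -> 'I_N) :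
    \sum_delta \prod_k modulus (link V delta k (a k) (b k)) <= kappa.
  apply: link_product_moment_le => //.
  exact: hadamard_entry_flat (H_hadamard N N0).
have := sum_signed_perm_trace_le kappa0 trA le_kappa.
rewrite -SE => le_S.
(* The power of [N] lost here is exactly the one gained in [kappa]. *)
have hs_le : \prod_k hilbert_schmidt (fun i j => A k i j) <=
    Num.sqrt N%:R ^+ n.+1 * \prod_k max_singular_value (A k).
  have -> : Num.sqrt N%:R ^+ n.+1 = \prod_(k < n.+1) Num.sqrt N%:R :> R.
    by rewrite prodr_const card_ord.
  rewrite -big_split; apply: ler_prod => k _.
  by rewrite sqrtr_ge0; exact: hilbert_schmidt_le.
set outcomes := (X in modulus X%:R^-1).
(* Dividing by the number of outcomes cancels the counting factors left by the plain sums. *)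
have outcomesE : outcomes%:R = N`!%:R * 2 ^+ N *
    #|{: {ffun I -> {ffun 'I_N -> bool}}}|%:R :> R.
  rewrite /outcomes !card_prod card_Sn card_ffun card_bool card_ord.
  by rewrite !natrM natrX [N`!%:R * _]mulrC.
have outcomes0 : 0 < outcomes%:R :> R.
  by rewrite ltr0n; apply/card_gt0P; exists ([ffun=> false], 1%g, [ffun=> [ffun=> false]]).
have -> : modulus (outcomes%:R^-1 : R[i]) = outcomes%:R^-1.
  by apply: complexI; rewrite modulusE normfV normr_nat fmorphV /= rmorph_nat.
rewrite ler_pdivrMl //; apply: le_trans le_S _.
set c0 := _ ^+ _.+2.
have c00 : 0 <= c0 by rewrite exprn_ge0.
apply: le_trans (ler_wpM2l _ hs_le) _.
  by apply: mulr_ge0 => //; apply: mulr_ge0 => //; rewrite mulr_ge0 ?exprn_ge0 ?ler0n.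
rewrite outcomesE /kappa le_eqVlt; apply/orP; left; apply/eqP.
have regroup (x a b y q e : R) : q != 0 ->
    x * (a * (b * y / q)) * (q * e) = a * b * (x * y * e) by move=> q0; field.
by apply: regroup; rewrite expf_neq0 // gt_eqF.
Qed.
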